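(* Let $n\ge 2$ be an integer and let $\psi:\mathbb{N}\to(0,\infty)$ be a function with $\psi(k)\to 0$ as $k\to\infty$. Let $$V(\psi)=\{\mathbf{x}\in[0,1]^n : |q_1x_1+\dots+q_nx_n|<\psi(|\mathbf{q}|)\ \text{for infinitely many } \mathbf{q}=(q_1,\dots,q_n)\in\mathbb{Z}^n\setminus\{\mathbf{0}\}\}.$$ Then the $n$-dimensional Lebesgue measure of $V(\psi)$ satisfies $$|V(\psi)|=\begin{cases}0 & \text{if } \sum_{k=1}^\infty k^{n-2}\psi(k) \text{ converges},\\ 1 & \text{if } \sum_{k=1}^\infty k^{n-2}\psi(k) \text{ diverges and } \psi \text{ is slowly decreasing}.\end{cases}$$
   Context: $\mathbb{N}=\{1,2,3,\dots\}$. For a vector $\mathbf{q}=(q_1,\dots,q_n)$, $|\mathbf{q}|=\max\{|q_1|,\dots,|q_n|\}$ denotes its height (sup norm). For a set $X\subseteq\mathbb{R}^n$, $|X|$ denotes its $n$-dimensional Lebesgue measure. A function $\psi:\mathbb{N}\to(0,\infty)$ is called slowly decreasing if it is decreasing (i.e. $\psi(k)\ge\psi(l)$ whenever $k\le l$) and for every $c\in(0,1)$ there exists a constant $K=K(c)>1$ such that $\psi(ck)\le K\psi(k)$ for all $k\in\mathbb{N}$ with $ck\in\mathbb{N}$. *)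

(* Defs.v *)
From HB Require Import structures.
From mathcomp Require Import all_boot all_order all_algebra.
From mathcomp Require Import all_classical all_reals all_analysis measurable_realfun.
Set Implicit Arguments.
Unset Strict Implicit.
Unset Printing Implicit Defensive.
Import Order.TTheory GRing.Theory Num.Theory.
Import numFieldNormedType.Exports.
Local Open Scope classical_set_scope.
Local Open Scope ring_scope.

(* The library puts on n.-tuple T the sigma-algebra generated by the n
   projections, here the Borel sets of R^n.  The entries are in measurableTypeR R,
   the type on which lebesgue_measure lives; it has the same measurable sets as
   R, but another display. *)
Notation euclidean R n := (n.-tuple (measurableTypeR R)).

Definition box (R : realType) n (A : 'I_n -> set (measurableTypeR R)) :
  set (euclidean R n) := [set x | forall i, A i (tnth x i)].

Lemma measurable_box (R : realType) n (A : 'I_n -> set (measurableTypeR R)) :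
  (forall i, measurable (A i)) -> measurable (box A).
Proof.
move=> mA; rewrite (_ : box A = \big[setI/setT]_(i < n)
  ((@tnth n (measurableTypeR R) ^~ i) @^-1` A i)).
  apply: big_ind => //; first exact: measurableI.
  by move=> i _; rewrite -[X in measurable X]setTI; exact: measurable_tnth.
rewrite -bigcap_seq; apply/seteqP; split=> x Ax i; first by move=> _; exact: Ax.
exact/Ax/mem_index_enum.
Qed.

Definition tuple_cons (R : realType) n
    (p : measurableTypeR R * euclidean R n) : euclidean R n.+1 :=
  [tuple of p.1 :: p.2].

Lemma measurable_tuple_cons (R : realType) n :
  measurable_fun setT (@tuple_cons R n).
Proof. exact: measurable_cons. Qed.

Lemma preimage_tuple_cons_box (R : realType) n
    (A : 'I_n.+1 -> set (measurableTypeR R)) :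
  @tuple_cons R n @^-1` box A = A ord0 `*` box (fun i => A (lift ord0 i)).
Proof.
apply/seteqP; split=> -[a x] /=.
  move=> Aax; split; first exact: (Aax ord0).
  by move=> i; have := Aax (lift ord0 i); rewrite tnthS.
move=> [Aa Ax] i; case: (unliftP ord0 i) => [j|] ->; last exact: Aa.
by rewrite tnthS; exact: Ax.
Qed.

Section lebesgue_measure_cons.
Context (R : realType) (n : nat).
Variable m : {sigma_finite_measure set (euclidean R n) -> \bar R}.
Local Open Scope ereal_scope.

Definition lebesgue_measure_cons : set (euclidean R n.+1) -> \bar R :=
  pushforward (@lebesgue_measure R \x m) (@tuple_cons R n).

Let cons0 : lebesgue_measure_cons set0 = 0.
Proof. by rewrite /lebesgue_measure_cons /pushforward preimage_set0 measure0. Qed.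

Let cons_ge0 A : 0 <= lebesgue_measure_cons A.
Proof. by rewrite /lebesgue_measure_cons /pushforward measure_ge0. Qed.

Let cons_sigma_additive : semi_sigma_additive lebesgue_measure_cons.
Proof.
have mcons A : measurable A -> measurable (@tuple_cons R n @^-1` A).
  by move=> mA; rewrite -[X in measurable X]setTI; exact: measurable_tuple_cons.
move=> F mF tF mUF; rewrite /lebesgue_measure_cons /pushforward preimage_bigcup.
apply: measure_semi_sigma_additive.
- by move=> i; exact: mcons.
- apply/trivIsetP => /= i j _ _ ij; rewrite -preimage_setI.
  by move/trivIsetP : tF => /(_ _ _ _ _ ij) ->//; rewrite preimage_set0.
- by rewrite -preimage_bigcup; exact: mcons.
Qed.

HB.instance Definition _ := isMeasure.Build _ _ _ lebesgue_measure_cons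
  cons0 cons_ge0 cons_sigma_additive.

Let cons_sigma_finite : sigma_finite setT lebesgue_measure_cons.
Proof.
have /sigma_finiteP[F [TF ndF Foo]] := sigma_finiteT (@lebesgue_measure R).
have /sigma_finiteP[G [TG ndG Goo]] := sigma_finiteT m.
pose f (x : euclidean R n.+1) : measurableTypeR R * euclidean R n :=
  (tnth x ord0, [tuple of behead x]).
have fK : cancel (@tuple_cons R n) f.
  by move=> [a x]; congr pair; exact/val_inj.
have mf : measurable_fun setT f.
  by apply: measurable_fun_pair; [exact: measurable_tnth|exact: measurable_behead].
exists (fun k => f @^-1` (F k `*` G k)).
  rewrite -preimage_bigcup; apply/esym/seteqP; split=> // x _ /=.
  have [k _ Fk] : (\bigcup_i F i) (f x).1 by rewrite -TF.
  have [l _ Gl] : (\bigcup_i G i) (f x).2 by rewrite -TG.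
  exists (maxn k l) => //; split.
    by move: Fk; exact/subsetPset/ndF/leq_maxl.
  by move: Gl; exact/subsetPset/ndG/leq_maxr.
move=> k; have [mFk Fkoo] := Foo k; have [mGk Gkoo] := Goo k.
split.
  rewrite -[X in measurable X]setTI.
  by apply: mf => //; exact: measurableX.
rewrite /lebesgue_measure_cons /pushforward -comp_preimage.
rewrite (_ : f \o _ = id) ?preimage_id; last exact/funext.
by rewrite product_measure1E// lte_mul_pinfty// ge0_fin_numE.
Qed.

HB.instance Definition _ := Measure_isSigmaFinite.Build _ _ _
  lebesgue_measure_cons cons_sigma_finite.

End lebesgue_measure_cons.

(* n-dimensional Lebesgue measure, as an iterated product; only its values on
   Borel sets are meaningful (and V n psi below is Borel, see measurable_V). *)
Fixpoint nlebesgue_measure (R : realType) (n : nat) :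
    {sigma_finite_measure set (euclidean R n) -> \bar R} :=
  match n with
  | 0 => \d_[tuple]
  | n'.+1 => lebesgue_measure_cons (nlebesgue_measure R n')
  end.

Lemma nlebesgue_measure_box (R : realType) n
    (A : 'I_n -> set (measurableTypeR R)) : (forall i, measurable (A i)) ->
  nlebesgue_measure R n (box A) = (\prod_(i < n) lebesgue_measure (A i))%E.
Proof.
elim: n A => [|n IH] A mA.
  by rewrite big_ord0 /= diracE mem_set// => -[].
rewrite /= /lebesgue_measure_cons /pushforward preimage_tuple_cons_box.
rewrite product_measure1E//; last exact: measurable_box.
by rewrite big_ord_recl -IH.
Qed.

Definition height n (q : 'rV[int]_n) : nat := \max_(i < n) `|q ord0 i|%N.

(* A function psi on {1, 2, ...} is represented by psi : nat -> R whose value at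
   0 is irrelevant.  In the second clause l is the integer c k. *)
Definition slowly_decreasing (R : realType) (psi : nat -> R) : Prop :=
  (forall k l : nat, (0 < k)%N -> (k <= l)%N -> psi l <= psi k) /\
  (forall c : R, 0 < c < 1 -> exists2 K : R, 1 < K &
    forall k l : nat, (0 < k)%N -> (0 < l)%N -> l%:R = c * k%:R ->
      psi l <= K * psi k).

Definition small_form (R : realType) n (psi : nat -> R) (x : euclidean R n)
    (q : 'rV[int]_n) : Prop :=
  q != 0 /\ `|\sum_(i < n) (q ord0 i)%:~R * tnth x i| < psi (height q).

Definition V (R : realType) (n : nat) (psi : nat -> R) : set (euclidean R n) :=
  [set x | (forall i, 0 <= tnth x i <= 1) /\ infinite_set (small_form psi x)].
Arguments V {R} n psi.

Lemma measurable_V (R : realType) n (psi : nat -> R) : measurable (V n psi).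
Proof.
pose E q : set (euclidean R n) := [set x | small_form psi x q].
have mE q : measurable (E q).
  have [->|q0] := eqVneq q 0.
    by rewrite (_ : E 0 = set0)//; apply/seteqP; split=> x // -[]; rewrite eqxx.
  have mf : measurable_fun setT
      (fun x : euclidean R n => `|\sum_(i < n) (q ord0 i)%:~R * tnth x i|).
    apply: measurableT_comp => //; apply: measurable_sum => i.
    by apply: measurable_funM => //; exact: measurable_tnth.
  rewrite (_ : E q = [set x | `|\sum_(i < n) (q ord0 i)%:~R * tnth x i|
    < psi (height q)]); last by apply/seteqP; split=> x => [[]|?].
  rewrite -[X in measurable X]setTI.
  by apply: (measurable_fun_ltr mf (measurable_cst (psi (height q)))
    measurableT (Y := [set true])).
rewrite (_ : V n psi = box (fun=> `[0, 1]%classic) `&` \bigcap_N \bigcup_q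
  (if (N <= pickle q)%N then E q else set0)).
  apply: measurableI; first exact: measurable_box.
  apply: bigcapT_measurable => N; apply: countable_bigcupT_measurable => [|q];
    [exact: countableP|by case: ifP].
apply/seteqP; split=> x.
  move=> [x01 xoo]; split=> [i|N _]; first by rewrite /= in_itv/= x01.
  have finN : finite_set [set q : 'rV[int]_n | (pickle q < N)%N].
    rewrite (_ : [set _ | _] = pickle @^-1` `I_N)//; apply: finite_preimage => //.
    by move=> q q' _ _; exact: (pcan_inj pickleK).
  have /infinite_setN0[q [xq /negP]] := infinite_setD xoo finN.
  by rewrite -leqNgt => Nq; exists q => //; rewrite Nq.
move=> [x01 xoo]; split=> [i|/finite_seqP[s sE]].
  by have := x01 i; rewrite /= in_itv.
have [N Nub] : exists N, forall q, small_form psi x q -> (pickle q < N)%N.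
  exists (\max_(q <- s) pickle q).+1 => q xq.
  rewrite ltnS; apply: leq_bigmax_seq => //.
  by have : [set` s] q by rewrite -sE.
have [q _] := xoo N I.
case: ifP => // Nq /Nub; by rewrite ltnNge Nq.
Qed.

(* Main.v *)
Require Import Defs.
From HB Require Import structures.
From mathcomp Require Import all_boot all_order all_algebra.
From mathcomp Require Import all_classical all_reals all_analysis.
From mathcomp Require Import cyclic measurable_realfun ring lra zify.
Import Order.TTheory GRing.Theory Num.Theory.
Import numFieldNormedType.Exports.
Local Open Scope classical_set_scope.
Local Open Scope ring_scope.

(* The set of x in the unit cube with |q.x| < delta has measure at most
   2 delta / |q|, and there are O(h^(n-1)) vectors q of height h, so the convergent
   case is the Borel-Cantelli lemma.

   In the divergent case, fix x_0 = t > 0 and write m = n - 1, L = M t >= 1 with M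
   an integer.  It suffices that for almost every x in [0, L[^m there are infinitely
   many q in Z^m with q.x within r(|q|) of L Z, where r(h) is a small constant times
   psi(C h): then q_0 is a multiple of M of size at most C |q|, and psi being slowly
   decreasing keeps the series divergent.  A second moment argument shows that the
   limsup set has measure at least L^m / D as soon as the events satisfy
   sum mu(A_i /\ A_j) <= D (sum mu(A_i))^2 / L^m + sum mu(A_i).
   - If m >= 2, use pairwise non-parallel q: the events are pairwise independent on
     the torus, because translating by s v with q.v = 0 and q'.v = 1 fixes the
     first event and averages out the second one; hence D = 1.
   - If m = 1, use the reduced fractions p/q: counting solutions of
     0 < |p q' - p' q| < K gives D = 128.  The intersection of these limsup sets over
     all constant multiples of r is invariant under rational translations and
     therefore, by Lebesgue's density theorem, of full measure.
   In both cases sum_{d <= N} phi(d) / d >= N / 2 provides enough vectors q. *)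

Set Implicit Arguments.
Unset Strict Implicit.
Unset Printing Implicit Defensive.

(** * Measurability and Fubini for the n-dimensional measure *)

Lemma measurable_norm_lt d (T : measurableType d) (R : realType)
    (f : T -> measurableTypeR R) (delta : R) : measurable_fun setT f ->
  measurable [set x | `|f x| < delta].
Proof.
move=> mf; rewrite (_ : [set x | _] = (Num.norm \o f) @^-1` `]-oo, delta[%classic).
  by rewrite -[X in measurable X]setTI; exact: measurableT_comp.
by apply/seteqP; split=> x; rewrite /= in_itv.
Qed.

Lemma fin_num_measure_setI d (T : measurableType d) (R : realType)
    (mu : {measure set T -> \bar R}) (A Q : set T) :
  measurable A -> measurable Q -> (mu Q < +oo)%E -> mu (A `&` Q) \is a fin_num.
Proof.
move=> mA mQ Qoo; rewrite ge0_fin_numE//; apply: le_lt_trans Qoo.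
by apply: le_measure; rewrite ?inE//; exact: measurableI.
Qed.

Section product_rectangle.
Context d1 d2 (T1 : measurableType d1) (T2 : measurableType d2) (R : realType).
Variable m1 : {sigma_finite_measure set T1 -> \bar R}.
Variable m2 : {sigma_finite_measure set T2 -> \bar R}.
Variables (A : set T1) (B : set T2) (f : T1 * T2 -> \bar R).
Hypotheses (mA : measurable A) (mB : measurable B).
Hypotheses (mf : measurable_fun setT f) (f0 : forall x, (0 <= f x)%E).
Local Open Scope ereal_scope.

Let mrestrict D : measurable D -> measurable_fun setT (f \_ D).
Proof. by move=> mD; apply/(measurable_restrictT _ mD); apply: measurable_funTS. Qed.

Let restrict_ge0 D x : 0 <= (f \_ D) x.
Proof. by apply: erestrict_ge0. Qed.

Lemma integral_product_rectangle : \int[m1 \x m2]_(p in A `*` B) f p =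
  \int[m1]_(a in A) \int[m2]_(x in B) f (a, x).
Proof.
rewrite integral_mkcond fubini_tonelli1; last 2 first.
- by apply: mrestrict; exact: measurableX.
- exact: restrict_ge0.
rewrite [RHS]integral_mkcond; apply: eq_integral => a _.
rewrite /fubini_F /patch; case: ifPn => aA.
  rewrite [RHS]integral_mkcond; apply: eq_integral => x _.
  by rewrite /patch in_setX aA.
by apply: integral0_eq => x _; rewrite in_setX (negbTE aA).
Qed.

Lemma measurable_fun_integral_section :
  measurable_fun setT (fun a => \int[m2]_(x in B) f (a, x)).
Proof.
have := measurable_fun_fubini_tonelli_F (m2 := m2) _
  (mrestrict (measurableX measurableT mB)) (@restrict_ge0 _).
rewrite (_ : fubini_F _ _ = fun a => \int[m2]_(x in B) f (a, x))//.
apply/funext => a; rewrite /fubini_F [RHS]integral_mkcond.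
by apply: eq_integral => x _; rewrite /patch in_setX in_setT.
Qed.

End product_rectangle.

Section nlebesgue_fubini.
Context (R : realType) (n : nat).
Local Notation mu := (@lebesgue_measure R).
Local Open Scope ereal_scope.

Lemma measurable_preimage_tuple_cons (A : set (euclidean R n.+1)) :
  measurable A -> measurable (@tuple_cons R n @^-1` A).
Proof.
by move=> mA; rewrite -[X in measurable X]setTI; exact: measurable_tuple_cons.
Qed.

Lemma measurable_section_tail (A : set (euclidean R n.+1)) t : measurable A ->
  measurable [set x : euclidean R n | A (tuple_cons (t, x))].
Proof.
move=> mA; rewrite -[X in measurable X]setTI.
have mf : measurable_fun setT
    (fun x : euclidean R n => tuple_cons (t : measurableTypeR R, x)).
  by apply: (measurableT_comp (@measurable_tuple_cons R n)); exact: pair1_measurable.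
exact: mf.
Qed.

Lemma measurable_section_head (A : set (euclidean R n.+1)) x : measurable A ->
  measurable [set a : measurableTypeR R | A (tuple_cons (a, x))].
Proof.
move=> mA; rewrite -[X in measurable X]setTI.
have mf : measurable_fun setT
    (fun a : measurableTypeR R => tuple_cons (a, x)).
  by apply: (measurableT_comp (@measurable_tuple_cons R n)); exact: pair2_measurable.
exact: mf.
Qed.

Lemma measurable_fun_measure_tail (A : set (euclidean R n.+1)) :
  measurable A -> measurable_fun setT (fun t : measurableTypeR R =>
    nlebesgue_measure R n [set x | A (tuple_cons (t, x))]).
Proof.
move=> mA; have := @measurable_fun_xsection _ _ _ _ R (nlebesgue_measure R n) _
  (measurable_preimage_tuple_cons mA).
congr measurable_fun; apply/funext => t /=; congr (nlebesgue_measure R n _).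
by apply/seteqP; split => x; rewrite /xsection /= inE.
Qed.

Lemma measurable_fun_measure_head (A : set (euclidean R n.+1)) :
  measurable A -> measurable_fun setT
    (fun x => mu [set a : measurableTypeR R | A (tuple_cons (a, x))]).
Proof.
move=> mA; have := @measurable_fun_ysection _ _ _ _ R mu _
  (measurable_preimage_tuple_cons mA).
congr measurable_fun; apply/funext => x /=; congr (mu _).
by apply/seteqP; split => a; rewrite /ysection /= inE.
Qed.

Lemma nlebesgue_measureS (A : set (euclidean R n.+1)) :
  nlebesgue_measure R n.+1 A =
  \int[mu]_a nlebesgue_measure R n [set x | A (tuple_cons (a, x))].
Proof.
rewrite /= /lebesgue_measure_cons /pushforward /product_measure1.
apply: eq_integral => a _ /=; congr (nlebesgue_measure R n _).
by apply/seteqP; split => x; rewrite /xsection /= inE.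
Qed.

(** The two iterated product measures agree on rectangles, hence everywhere by uniqueness. This
    order of integration serves when the nonzero coefficient of a linear form is the first one. *)
Lemma nlebesgue_measureS_swap (A : set (euclidean R n.+1)) : measurable A ->
  nlebesgue_measure R n.+1 A =
  \int[nlebesgue_measure R n]_x mu [set a | A (tuple_cons (a, x))].
Proof.
move=> mA; have mcA := measurable_preimage_tuple_cons mA.
rewrite /= /lebesgue_measure_cons /pushforward.
rewrite (@product_measure_unique _ _ _ _ _ _ _ (mu \x^ nlebesgue_measure R n)%E)//=;
  last by move=> *; rewrite product_measure2E.
apply: eq_integral => a _ /=; congr (mu _).
by apply/seteqP; split => x; rewrite /ysection /= inE.
Qed.

Lemma nlebesgue_unit_cube : nlebesgue_measure R n (@box R n (fun=> `[0%R, 1%R]%classic)) = 1%E.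
Proof.
rewrite nlebesgue_measure_box// big1// => i _.
by rewrite lebesgue_measure_itv/= lte_fin ltr01 oppr0 adde0.
Qed.

Lemma measurable_comp_tuple_cons (f : euclidean R n.+1 -> \bar R) :
  measurable_fun setT f -> measurable_fun setT (f \o @tuple_cons R n).
Proof. by move=> mf; exact: (measurableT_comp mf (@measurable_tuple_cons R n)). Qed.

Lemma integral_nlebesgueS (I : set (measurableTypeR R))
    (f : euclidean R n.+1 -> \bar R) :
  measurable I -> measurable_fun setT f -> (forall x, 0 <= f x) ->
  \int[nlebesgue_measure R n.+1]_(x in box (fun=> I)) f x =
  \int[mu]_(a in I) \int[nlebesgue_measure R n]_(x in box (fun=> I))
     f (tuple_cons (a, x)).
Proof.
move=> mI mf f0; have mB k : measurable (@box R k (fun=> I)).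
  exact: measurable_box.
rewrite (@ge0_integral_pushforward _ _ _ _ _ _ (@measurable_tuple_cons R n)
  (mu \x nlebesgue_measure R n)%E)//.
rewrite preimage_tuple_cons_box.
exact: (@integral_product_rectangle _ _ _ _ R mu (nlebesgue_measure R n) _ _
  _ mI (mB n) (measurable_comp_tuple_cons mf) (fun p => f0 _)).
- exact: mB.
- exact: measurable_funTS.
Qed.

Lemma measurable_fun_nlebesgue_section (I : set (measurableTypeR R))
    (f : euclidean R n.+1 -> \bar R) :
  measurable I -> measurable_fun setT f -> (forall x, 0 <= f x) ->
  measurable_fun setT (fun a : measurableTypeR R =>
     \int[nlebesgue_measure R n]_(x in box (fun=> I)) f (tuple_cons (a, x))).
Proof.
move=> mI mf f0.
have mB : measurable (@box R n (fun=> I)) by exact: measurable_box.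
exact: (@measurable_fun_integral_section _ _ _ _ R (nlebesgue_measure R n)
  _ _ mB (measurable_comp_tuple_cons mf) (fun p => f0 _)).
Qed.

End nlebesgue_fubini.

(** * Translation invariance of integrals over a period *)

Section periodic_shift.
Context (R : realType).
Local Notation mu := (@lebesgue_measure R).
Local Open Scope ereal_scope.

Lemma measurable_addr (s : R) :
  measurable_fun setT (fun y : measurableTypeR R => (y + s)%R : measurableTypeR R).
Proof. exact: measurable_funD. Qed.

(** The pushforward of [mu] under the translation gives every half-open interval its length, so the
    uniqueness of Lebesgue measure applies. *)
Lemma lebesgue_measure_shift (s : R) (A : set (measurableTypeR R)) :
  measurable A -> mu ((fun y : measurableTypeR R => (y + s)%R) @^-1` A) = mu A.
Proof.
move=> mA; pose f := (fun y : measurableTypeR R => (y + s)%R : measurableTypeR R).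
pose mf_ := isMeasurableFun.Build _ _ _ _ f (measurable_addr s).
pose F : {mfun measurableTypeR R >-> measurableTypeR R} := HB.pack f mf_.
apply/esym/(@lebesgue_measure_unique R (pushforward mu F)) => //.
move=> _ [[a b]] _ <-; rewrite /pushforward.
transitivity (mu `](a - s)%R, (b - s)%R]%classic).
  by rewrite !lebesgue_measure_itv/= !lte_fin ltrD2r -!EFinB opprB addrA subrK.
by congr (mu _); apply/seteqP; split=> y; rewrite /= !in_itv/= ltrBlDr lerBrDr.
Qed.

Lemma integral_shift (s a b : R) (h : measurableTypeR R -> \bar R) :
  measurable_fun setT h -> (forall y, 0 <= h y) ->
  \int[mu]_(y in `[a, b[) h (y + s)%R = \int[mu]_(y in `[(a + s)%R, (b + s)%R[) h y.
Proof.
move=> mh h0.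
transitivity (\int[pushforward mu
    (fun y : measurableTypeR R => (y + s)%R : measurableTypeR R)]_(y in
      `[(a + s)%R, (b + s)%R[) h y).
  rewrite ge0_integral_pushforward//; last 2 first.
  - exact: measurable_addr.
  - exact: measurable_funTS.
  by congr integral; apply/seteqP; split=> y; rewrite /= !in_itv/= lerD2r ltrD2r.
pose f := (fun y : measurableTypeR R => (y + s)%R : measurableTypeR R).
pose mf_ := isMeasurableFun.Build _ _ _ _ f (measurable_addr s).
pose F : {mfun measurableTypeR R >-> measurableTypeR R} := HB.pack f mf_.
apply: (@eq_measure_integral _ _ _ _ mu (pushforward mu F)) => A mA _.
exact: lebesgue_measure_shift.
Qed.

(* Reduce to 0 <= s < L, then exchange the pieces [s, L[ and [L, L + s[ = [0, s[ + L. *)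
Lemma integral_periodic_shift (L s : R) (h : measurableTypeR R -> \bar R) :
  (0 < L)%R -> measurable_fun setT h -> (forall y, 0 <= h y) ->
  (forall (z : int) y, h (y + z%:~R * L)%R = h y) ->
  \int[mu]_(y in `[0%R, L[) h (y + s)%R = \int[mu]_(y in `[0%R, L[) h y.
Proof.
move=> L0 mh h0 hper.
pose z := Num.floor (s / L)%R; pose r := (s - z%:~R * L)%R.
have /andP[r0 rL] : (0 <= r < L)%R.
  have /andP[] := floor_itv (s / L)%R; rewrite -/z intrD.
  rewrite ler_pdivlMr// ltr_pdivrMr// mulrDl mul1r /r => ? ?.
  by apply/andP; split; lra.
transitivity (\int[mu]_(y in `[0%R, L[) h (y + r)%R).
  by apply: eq_integral => y _; rewrite -(hper z (y + r)%R) /r addrA subrK.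
rewrite integral_shift// add0r.
have split1 (a b c : R) : (a <= b)%R -> (b <= c)%R ->
    \int[mu]_(y in `[a, c[) h y =
    \int[mu]_(y in `[a, b[) h y + \int[mu]_(y in `[b, c[) h y.
  move=> ab bc; rewrite -ge0_integral_setU//=.
  - congr integral; apply/seteqP; split=> y /=; rewrite !in_itv/=.
      by move=> /andP[ay yc]; case: (ltP y b) => yb; [left|right]; rewrite ?ay ?yb ?yc.
    case=> /andP[u v]; apply/andP; split => //; first exact: lt_le_trans bc.
    exact: le_trans u.
  - exact: measurable_funTS.
  - apply/disj_setPS => y /=; rewrite !in_itv/= => -[/andP[_ yb] /andP[by_ _]].
    by move: (lt_le_trans yb by_); rewrite ltxx.
rewrite (split1 r L (L + r)%R) ?lerDl ?(ltW rL)//.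
rewrite (split1 0%R r L) ?(ltW rL)// addeC; congr (_ + _).
rewrite -{1}[L]add0r [(L + r)%R]addrC -integral_shift//.
by apply: eq_integral => y _; rewrite -[RHS](hper 1%R) mul1r.
Qed.

End periodic_shift.

Section torus_shift.
Context (R : realType) (L : R) (L0 : 0 < L).
Local Open Scope ereal_scope.

(** Such an [F] descends to the torus obtained from R^n modulo (L Z)^n; the cube [0, L[^n serves as
    a fundamental domain. *)
Definition torus_periodic n (F : euclidean R n -> \bar R) :=
  forall x y, (forall i, exists z : int, tnth y i = tnth x i + z%:~R * L)%R ->
    F y = F x.

Definition shift_tuple n (v : 'I_n -> R) (x : euclidean R n) : euclidean R n :=
  [tuple (tnth x i + v i)%R | i < n].

Lemma measurable_shift_tuple n (v : 'I_n -> R) :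
  measurable_fun setT (@shift_tuple n v).
Proof.
apply/measurable_fun_tnthP => i.
rewrite (_ : _ \o _ = fun x => (tnth x i + v i)%R); last first.
  by apply/funext => x /=; rewrite tnth_mktuple.
by apply: measurable_funD => //; exact: measurable_tnth.
Qed.

Lemma tuple_cons_shift n (v : 'I_n.+1 -> R) a (x : euclidean R n) :
  shift_tuple v (tuple_cons (a, x)) =
  tuple_cons ((a + v ord0)%R, shift_tuple (v \o lift ord0) x).
Proof.
apply: eq_from_tnth => i; rewrite tnth_mktuple.
case: (unliftP ord0 i) => [j|] -> //=.
by rewrite !tnthS tnth_mktuple.
Qed.

(** Induction on the dimension by Tonelli: for a fixed head the tail is translated by the induction
    hypothesis, then the head by [integral_periodic_shift]. *)
Lemma integral_torus_shift n (v : 'I_n -> R) (F : euclidean R n -> \bar R) :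
  measurable_fun setT F -> (forall x, 0 <= F x) -> torus_periodic F ->
  \int[nlebesgue_measure R n]_(x in box (fun=> `[0%R, L[%classic)) F (shift_tuple v x) =
  \int[nlebesgue_measure R n]_(x in box (fun=> `[0%R, L[%classic)) F x.
Proof.
elim: n v F => [|n IH] v F mF F0 pF.
  by apply: eq_integral => x _; congr F; apply: eq_from_tnth => -[].
have mI : measurable (`[0%R, L[%classic : set (measurableTypeR R)) by [].
have mFs : measurable_fun setT (fun x => F (shift_tuple v x)).
  exact: (measurableT_comp mF (@measurable_shift_tuple _ v)).
rewrite (integral_nlebesgueS mI mFs (fun=> F0 _)) (integral_nlebesgueS mI mF F0).
pose h a := \int[nlebesgue_measure R n]_(x in box (fun=> `[0%R, L[%classic))
  F (tuple_cons (a, x)).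
transitivity (\int[lebesgue_measure]_(a in `[0%R, L[) h (a + v ord0)%R).
  apply: eq_integral => a _; rewrite /h.
  rewrite -(IH (v \o lift ord0) (fun x => F (tuple_cons ((a + v ord0)%R, x)))).
  - by apply: eq_integral => x _; rewrite tuple_cons_shift.
  - exact: (measurableT_comp (measurable_comp_tuple_cons mF) (measurable_pair1 _)).
  - by move=> x; exact: F0.
  - move=> x y xy; apply: pF => i; case: (unliftP ord0 i) => [j|] ->.
      by rewrite !tnthS; exact: xy.
    by exists 0%R; rewrite /= mul0r addr0.
apply: integral_periodic_shift => //.
- exact: measurable_fun_nlebesgue_section.
- by move=> y; exact: integral_ge0.
- move=> z y; apply: eq_integral => x _; apply: pF => i.
  case: (unliftP ord0 i) => [j|] ->; last by exists z.
  by exists 0%R; rewrite !tnthS mul0r addr0.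
Qed.

End torus_shift.

(** * Independence on the torus *)

Section fubini_rectangle.
Context d1 d2 (T1 : measurableType d1) (T2 : measurableType d2) (R : realType).
Variable m1 : {sigma_finite_measure set T1 -> \bar R}.
Variable m2 : {sigma_finite_measure set T2 -> \bar R}.
Variables (A : set T1) (B : set T2) (f : T1 -> T2 -> \bar R).
Hypotheses (mA : measurable A) (mB : measurable B).
Hypotheses (mf : measurable_fun setT (fun p => f p.1 p.2)).
Hypotheses (f0 : forall x y, (0 <= f x y)%E).
Local Open Scope ereal_scope.

Lemma fubini_tonelli_rectangle :
  \int[m1]_(x in A) \int[m2]_(y in B) f x y =
  \int[m2]_(y in B) \int[m1]_(x in A) f x y.
Proof.
pose g (p : T1 * T2) := ((fun p => f p.1 p.2) \_ (A `*` B)) p.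
have mg : measurable_fun setT g.
  apply/(measurable_restrictT _ (measurableX mA mB)).
  exact: measurable_funTS.
have g0 p : 0 <= g p by apply: erestrict_ge0 => -[].
transitivity (\int[m1]_x \int[m2]_y g (x, y)).
  rewrite integral_mkcond; apply: eq_integral => x _; rewrite /patch.
  case: ifPn => xA.
    rewrite integral_mkcond; apply: eq_integral => y _.
    by rewrite /g /patch in_setX xA.
  by apply/esym/integral0_eq => y _; rewrite /g /patch in_setX (negbTE xA).
rewrite (fubini_tonelli g mg g0) [RHS]integral_mkcond.
apply: eq_integral => y _; rewrite /patch; case: ifPn => yB.
  rewrite [RHS]integral_mkcond; apply: eq_integral => x _.
  by rewrite /g /patch in_setX yB andbT.
by apply: integral0_eq => x _; rewrite /g /patch in_setX (negbTE yB) andbF.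
Qed.

End fubini_rectangle.

Definition lin (R : realType) n (q : 'I_n -> int) (x : euclidean R n) : R :=
  \sum_(i < n) (q i)%:~R * tnth x i.

Lemma measurable_lin (R : realType) n (q : 'I_n -> int) :
  measurable_fun setT (@lin R n q : _ -> measurableTypeR R).
Proof.
apply: measurable_sum => i; apply: measurable_funM => //.
exact: measurable_tnth.
Qed.

Lemma lin_shift (R : realType) n (q : 'I_n -> int) v (x : euclidean R n) :
  lin q (shift_tuple v x) = lin q x + \sum_i (q i)%:~R * v i.
Proof.
by rewrite /lin -big_split; apply: eq_bigr => i _; rewrite tnth_mktuple mulrDr.
Qed.

Section torus_average.
Context (R : realType) (L : R) (L0 : 0 < L) (n : nat).
Local Notation mu := (@lebesgue_measure R).
Local Notation mun := (nlebesgue_measure R n).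
Local Notation Q := (@box R n (fun=> `[0%R, L[%classic)).
Local Open Scope ereal_scope.

Definition lattice_periodic (f : measurableTypeR R -> \bar R) :=
  forall (z : int) y, f (y + z%:~R * L)%R = f y.

(** Since q has integer entries, moving x by a vector L z of the lattice changes q.x by L (q.z), a
    multiple of L. *)
Lemma torus_periodic_lin (f : measurableTypeR R -> \bar R) (q : 'I_n -> int) :
  lattice_periodic f -> torus_periodic L (fun x => f (lin q x)).
Proof.
move=> pf x y /choice[z yx].
rewrite (_ : lin q y = lin q x + (\sum_i q i * z i)%:~R * L)%R ?pf//.
rewrite /lin rmorph_sum /= mulr_suml -big_split /=.
by apply: eq_bigr => i _; rewrite yx rmorphM /=; ring.
Qed.

(* Translating by s v with q.v = 1 replaces q.x by q.x + s and leaves G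
   unchanged; averaging over s in a period decouples the two factors. *)
Lemma torus_average (f : measurableTypeR R -> \bar R) (q : 'I_n -> int)
    (G : euclidean R n -> \bar R) (v : 'I_n -> R) :
  measurable_fun setT f -> (forall y, 0 <= f y) -> lattice_periodic f ->
  measurable_fun setT G -> (forall x, 0 <= G x) -> torus_periodic L G ->
  (\sum_i (q i)%:~R * v i = 1)%R ->
  (forall s x, G (shift_tuple (fun i => s * v i)%R x) = G x) ->
  L%:E * \int[mun]_(x in Q) (f (lin q x) * G x) =
  (\int[mu]_(y in `[0%R, L[) f y) * \int[mun]_(x in Q) G x.
Proof.
move=> mf f0 pf mG G0 pG qv Gv.
have mI : measurable (`[0%R, L[%classic : set (measurableTypeR R)) by [].
have mQ : measurable Q by exact: measurable_box.
have mH : measurable_fun setT (fun x => f (lin q x) * G x).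
  by apply: emeasurable_funM => //; exact: (measurableT_comp mf (measurable_lin q)).
have H0 x : 0 <= f (lin q x) * G x by exact: mule_ge0.
have pH : torus_periodic L (fun x => f (lin q x) * G x).
  by move=> x y xy; rewrite (pG _ _ xy) (torus_periodic_lin q pf xy).
transitivity (\int[mu]_(s in `[0%R, L[) \int[mun]_(x in Q) (f (lin q x + s)%R * G x)).
  rewrite muleC; set J := \int[mun]_(x in Q) _.
  transitivity (J * mu `[0%R, L[%classic).
    by rewrite lebesgue_measure_itv/= lte_fin L0 oppr0 adde0.
  rewrite -(integral_cst mu mI J); apply: eq_integral => s _; rewrite /cst /J.
  rewrite -(integral_torus_shift L0 (fun i => s * v i)%R mH H0 pH).
  apply: eq_integral => x _; rewrite Gv lin_shift; congr (f (_ + _)%R * _).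
  by under eq_bigr do rewrite mulrCA; rewrite -mulr_sumr qv mulr1.
have mfs : measurable_fun setT (fun p : measurableTypeR R * euclidean R n =>
    f (lin q p.2 + p.1)%R * G p.2).
  apply: emeasurable_funM.
    apply: (measurableT_comp mf); apply: measurable_funD => //.
    exact: (measurableT_comp (measurable_lin q) measurable_snd).
  exact: (measurableT_comp mG measurable_snd).
rewrite (@fubini_tonelli_rectangle _ _ _ _ R mu mun _ _ _ mI mQ mfs); last first.
  by move=> s x; exact: mule_ge0.
rewrite -ge0_integralZl//; last 2 first.
- exact: measurable_funTS.
- by apply: integral_ge0 => y _.
apply: eq_integral => x _.
rewrite ge0_integralZr//; last first.
  by apply: measurable_funTS; apply: (measurableT_comp mf); exact: measurable_funD.
congr (_ * _).
under eq_integral do rewrite addrC.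
exact: integral_periodic_shift.
Qed.

End torus_average.

(** * Strips around the hyperplanes on which q.x is a multiple of L *)

Definition near_multiples (R : realType) (L r : R) : set (measurableTypeR R) :=
  [set u | exists p : int, `|u - p%:~R * L| < r].

Definition strip (R : realType) (L : R) n (q : 'I_n -> int) (r : R) :
  set (euclidean R n) := lin q @^-1` near_multiples L r.

Section strips.
Context (R : realType) (L : R) (L0 : 0 < L).
Local Notation mu := (@lebesgue_measure R).
Local Notation I := (`[0%R, L[%classic : set (measurableTypeR R)).

Lemma measurable_near_multiples r : measurable (near_multiples L r).
Proof.
rewrite (_ : near_multiples L r =
    \bigcup_(p in [set: int]) `](p%:~R * L - r), (p%:~R * L + r)[%classic).
  by apply: countable_bigcupT_measurable => [|p]; [exact: countableP|exact: measurable_itv].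
by apply/seteqP; split=> u /= [p]; [move=> up|move=> _ up]; exists p => //; move: up;
  rewrite /= in_itv/= ltr_distl.
Qed.

Lemma near_multiples_periodic r (z : int) u :
  near_multiples L r (u + z%:~R * L) <-> near_multiples L r u.
Proof.
split=> -[p up].
  by exists (p - z); congr (`|_| < r): up; rewrite rmorphB /=; ring.
by exists (p + z); congr (`|_| < r): up; rewrite rmorphD /=; ring.
Qed.

(** Only the piece [0, r[ to the right of the multiple 0 is kept; a lower bound linear in r is
    enough for sums of measures to diverge. *)
Lemma near_multiples_size r : 0 < r -> r <= L ->
  (r%:E <= mu (near_multiples L r `&` I))%E.
Proof.
move=> r0 rL.
have -> : (r%:E = mu `[0%R, r[%classic)%E.
  by rewrite lebesgue_measure_itv/= lte_fin r0 oppr0 adde0.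
apply: le_measure; rewrite ?inE//.
  by apply: measurableI => //; exact: measurable_near_multiples.
move=> u; rewrite /= in_itv/= => /andP[u0 ur]; split.
  by exists 0; rewrite mul0r subr0 ger0_norm.
by rewrite /= in_itv/= u0 (lt_le_trans ur).
Qed.

Context (n : nat).
Local Notation mun := (nlebesgue_measure R n).
Local Notation Q := (@box R n (fun=> `[0%R, L[%classic)).

Lemma measurable_cube : measurable Q. Proof. exact: measurable_box. Qed.

Lemma nlebesgue_cube : mun Q = (L ^+ n)%:E.
Proof.
rewrite nlebesgue_measure_box//.
rewrite (eq_bigr (fun=> L%:E)); last first.
  by move=> i _; rewrite lebesgue_measure_itv/= lte_fin L0 oppr0 adde0.
by rewrite prodEFin prodr_const card_ord.
Qed.

Lemma measurable_strip (q : 'I_n -> int) r : measurable (strip L q r).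
Proof.
rewrite /strip -[X in measurable X]setTI.
exact: (measurable_lin q measurableT (measurable_near_multiples r)).
Qed.

Local Open Scope ereal_scope.

Let f r (u : measurableTypeR R) : \bar R := (\1_(near_multiples L r) u)%:E.

Let mf r : measurable_fun setT (f r).
Proof.
by apply/measurable_EFinP; apply: measurable_indic; exact: measurable_near_multiples.
Qed.

Let f0 r y : 0 <= f r y. Proof. by rewrite lee_fin. Qed.

Let pf r : lattice_periodic L (f r).
Proof.
move=> z y; rewrite /f !indicE; congr (nat_of_bool _)%:R%:E.
by apply/idP/idP; rewrite !inE => /near_multiples_periodic.
Qed.

Let int_f r : \int[mu]_(y in `[0%R, L[) f r y = mu (near_multiples L r `&` I).
Proof. by rewrite integral_indic//; exact: measurable_near_multiples. Qed.

Let int_strip q r : \int[mun]_(x in Q) f r (lin q x) = mun (strip L q r `&` Q).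
Proof.
have -> : (fun x => f r (lin q x)) = (fun x => (\1_(strip L q r) x)%:E).
  by apply/funext => x.
rewrite integral_indic//; [exact: measurable_cube|exact: measurable_strip].
Qed.

(** This is [torus_average] with G = 1 and the direction v supported on the coordinate [i0]: the
    measure of a strip depends on its width and not on the nonzero vector q. *)
Lemma strip_scaled_measure (q : 'I_n -> int) r : (exists i, q i != 0%R) ->
  L%:E * mun (strip L q r `&` Q) = mu (near_multiples L r `&` I) * mun Q.
Proof.
move=> [i0 qi0].
have := @torus_average R L L0 n (f r) q (cst 1) (fun i => (i == i0)%:R / (q i0)%:~R)%R
  (mf r) (f0 r) (@pf r).
rewrite int_f (integral_cst mun measurable_cube) mul1e.
move=> <- //.
- congr (_ * _); rewrite -int_strip; apply: eq_integral => x _.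
  by rewrite mule1.
- rewrite (bigD1 i0)//= eqxx mul1r divff ?intr_eq0// big1 ?addr0// => i /negbTE ->.
  by rewrite mul0r mulr0.
Qed.

Lemma strip_size (q : 'I_n -> int) r : (exists i, q i != 0%R) ->
  (0 < r)%R -> (r <= L)%R ->
  r%:E * mun Q <= L%:E * mun (strip L q r `&` Q).
Proof.
move=> q0 r0 rL; rewrite strip_scaled_measure//.
by apply: lee_wpmul2r => //; exact: near_multiples_size.
Qed.

(** A nonzero minor provides v with q.v = 1 and q'.v = 0. The indicator of the second strip is then
    invariant along v, and [torus_average] separates the two strips. *)
Lemma strip_independence (q q' : 'I_n -> int) r r' i j :
  (q i * q' j - q j * q' i != 0)%R ->
  mun Q * mun (strip L q r `&` strip L q' r' `&` Q) =
  mun (strip L q r `&` Q) * mun (strip L q' r' `&` Q).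
Proof.
move=> minor.
have q0 : exists i, q i != 0%R.
  apply/not_existsP => q0; move: minor.
  have z k : q k = 0%R by apply/eqP; have /negP := q0 k; rewrite negbK.
  by rewrite !z !mul0r subrr eqxx.
pose d : R := (q i * q' j - q j * q' i)%:~R%R.
have d0 : d != 0%R by rewrite intr_eq0.
(* Cramer's rule on the coordinates i and j solves q.v = 1 and q'.v = 0. *)
pose v k : R := ((k == i)%:R * (q' j)%:~R / d - (k == j)%:R * (q' i)%:~R / d)%R.
have sumv (a : 'I_n -> int) : (\sum_k (a k)%:~R * v k =
    ((a i)%:~R * (q' j)%:~R - (a j)%:~R * (q' i)%:~R) / d)%R.
  pose e (k : 'I_n) : R := ((a k)%:~R / d)%R.
  have pick (l : 'I_n) (c : R) : (\sum_k (a k)%:~R * ((k == l)%:R * c / d) =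
      (a l)%:~R * c / d)%R.
    rewrite (bigD1 l)//= eqxx mul1r mulrA big1 ?addr0// => k /negbTE ->.
    by rewrite !mul0r mulr0.
  under eq_bigr do rewrite mulrBr.
  by rewrite sumrB !pick mulrBl.
have := @torus_average R L L0 n (f r) q (fun x => f r' (lin q' x)) v
  (mf r) (f0 r) (@pf r).
rewrite int_f int_strip => H.
have {H} H : L%:E * mun (strip L q r `&` strip L q' r' `&` Q) =
    mu (near_multiples L r `&` I) * mun (strip L q' r' `&` Q).
  rewrite -H.
  - congr (_ * _).
    rewrite -[LHS]integral_indic; last 2 first.
    + exact: measurable_cube.
    + by apply: measurableI; exact: measurable_strip.
    apply: eq_integral => x _; rewrite /f -EFinM !indicE -natrM mulnb.
    by rewrite in_setI.
  - exact: (measurableT_comp (mf r') (measurable_lin q')).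
  - by [].
  - exact: torus_periodic_lin.
  - by rewrite sumv (_ : (_ - _)%R = d) ?divff// /d rmorphB /= !rmorphM.
  - move=> s x; rewrite lin_shift.
    under eq_bigr do rewrite mulrCA.
    rewrite -mulr_sumr sumv.
    by rewrite [X in (X / d)%R](_ : _ = 0)%R ?mul0r ?mulr0 ?addr0// mulrC subrr.
(* The averages come with a factor L, so the identity is proved after multiplication by L, a
   positive real that can be cancelled among extended reals. *)
suff E : L%:E * (mun Q * mun (strip L q r `&` strip L q' r' `&` Q)) =
    L%:E * (mun (strip L q r `&` Q) * mun (strip L q' r' `&` Q)).
  by apply/le_anti/andP; split; rewrite -(@lee_pmul2l _ L%:E)// E.
by rewrite muleCA H !muleA strip_scaled_measure// [X in X * _]muleC.
Qed.

End strips.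

(** * A divergence Borel-Cantelli lemma *)

Section kochen_stone.
Context d (T : measurableType d) (R : realType).
Variable mu : {measure set T -> \bar R}.
Variables (Q : set T) (Lam : R).
Hypotheses (mQ : measurable Q) (Lam0 : 0 < Lam) (muQ : mu Q = Lam%:E).
Variables (I : Type) (s : nat -> seq I) (B : I -> set T).
Hypothesis mB : forall i, measurable (B i).

Definition hits H x := count (fun i => x \in B i) (s H).

Definition mean H : R := \sum_(i <- s H) fine (mu (B i `&` Q)).

Definition correlation H : R :=
  \sum_(i <- s H) \sum_(j <- s H) fine (mu (B i `&` B j `&` Q)).

Lemma hitsE H x : (hits H x)%:R = \sum_(i <- s H) \1_(B i) x :> R.
Proof.
rewrite /hits -sum1_count natr_sum big_mkcond /=; apply: eq_bigr => i _.
by rewrite indicE; case: (x \in B i).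
Qed.

Let fin_muI A : measurable A -> mu (A `&` Q) \is a fin_num.
Proof. by move=> mA; apply: fin_num_measure_setI => //; rewrite muQ ltry. Qed.

Lemma measurable_hits H j : measurable [set x | (j < hits H x)%N].
Proof.
have mf : measurable_fun setT (fun x => \sum_(i <- s H) \1_(B i) x : R).
  by apply: measurable_sum => i; exact: measurable_indic.
rewrite (_ : [set x | _] = (fun x => \sum_(i <- s H) \1_(B i) x : R) @^-1` `]j%:R, +oo[).
  by rewrite -[X in measurable X]setTI; exact: mf.
by apply/seteqP; split=> x; rewrite /= in_itv/= andbT -hitsE ltr_nat.
Qed.

Lemma measurable_hits_unbounded :
  measurable [set x | forall j, exists H, (j < hits H x)%N].
Proof.
rewrite (_ : [set x | _] = \bigcap_j \bigcup_H [set x | (j < hits H x)%N]).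
  by apply: bigcapT_measurable => j; apply: bigcupT_measurable => H; exact: measurable_hits.
apply/seteqP; split=> x xU j; first by move=> _; have [H] := xU j; exists H.
by have [H _ jH] := xU j Logic.I; exists H.
Qed.

Local Open Scope ereal_scope.

Lemma integral_hits H : \int[mu]_(x in Q) (hits H x)%:R%:E = (mean H)%:E.
Proof.
rewrite /mean -sumEFin; under eq_integral do rewrite hitsE -sumEFin.
rewrite ge0_integral_sum//; last first.
  by move=> i; apply/measurable_EFinP; exact: measurable_indic.
apply: eq_bigr => i _.
by rewrite integral_indic// fineK//; exact: fin_muI.
Qed.

Lemma integral_sqr_hits H :
  \int[mu]_(x in Q) ((hits H x)%:R ^+ 2)%:E = (correlation H)%:E.
Proof.
rewrite /correlation -sumEFin.
have mE i : measurable_fun Q (fun x => (\1_(B i) x)%:E : \bar R).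
  by apply/measurable_EFinP; exact: measurable_indic.
transitivity (\int[mu]_(x in Q) \sum_(i <- s H) \sum_(j <- s H)
    (\1_(B i `&` B j) x)%:E).
  apply: eq_integral => x _; rewrite hitsE expr2 mulr_suml -sumEFin.
  apply: eq_bigr => i _; rewrite mulr_sumr -sumEFin; apply: eq_bigr => j _.
  by rewrite indicI.
have mBB i j : measurable (B i `&` B j) by exact: measurableI.
have mEE i j : measurable_fun Q (fun x => (\1_(B i `&` B j) x)%:E : \bar R).
  by apply/measurable_EFinP; exact: measurable_indic.
rewrite ge0_integral_sum//; last 2 first.
- by move=> i; exact: emeasurable_sum.
- by move=> i x _; exact: sume_ge0.
apply: eq_bigr => i _; rewrite ge0_integral_sum// -sumEFin.
apply: eq_bigr => j _.
by rewrite integral_indic// fineK//; exact: fin_muI.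
Qed.

(* Integrate 2 a S <= a^2 S^2 + 1_{S > j} + 2 a j. *)
Lemma measure_hits_ge H j (a : R) : (0 <= a)%R ->
  (2 * a * mean H)%:E <= (a ^+ 2 * correlation H)%:E +
    mu ([set x | (j < hits H x)%N] `&` Q) + (2 * a * j%:R * Lam)%:E.
Proof.
move=> a0; have mN : measurable_fun Q (fun x => (hits H x)%:R%:E : \bar R).
  apply/measurable_EFinP; under eq_fun do rewrite hitsE.
  by apply: measurable_sum => i; exact: measurable_indic.
have mN2 : measurable_fun Q (fun x => ((hits H x)%:R ^+ 2)%:E : \bar R).
  by apply/measurable_EFinP; apply: measurable_funX; apply/measurable_EFinP.
have mU : measurable [set x | (j < hits H x)%N] := measurable_hits H j.
have m1 : measurable_fun Q (fun x => (\1_[set x | (j < hits H x)%N] x)%:E : \bar R).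
  by apply/measurable_EFinP; exact: measurable_indic.
rewrite [(_ * mean H)%:E]EFinM -integral_hits -ge0_integralZl_EFin//; last by rewrite mulr_ge0.
rewrite [(a ^+ 2 * _)%:E]EFinM -integral_sqr_hits.
rewrite -ge0_integralZl_EFin ?sqr_ge0//.
rewrite -integral_indic// [(_ * Lam)%:E]EFinM -muQ -integral_cst//.
have m2 : measurable_fun Q (fun x => (a ^+ 2)%:E * ((hits H x)%:R ^+ 2)%:E).
  exact: measurable_funeM.
rewrite -ge0_integralD//; last by move=> x _; rewrite -EFinM lee_fin mulr_ge0// sqr_ge0.
rewrite -ge0_integralD//; last 3 first.
- by move=> x _; rewrite adde_ge0// -EFinM lee_fin mulr_ge0// sqr_ge0.
- exact: emeasurable_funD.
- by move=> x _; rewrite lee_fin !mulr_ge0.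
apply: ge0_le_integral => //.
- by move=> x _; rewrite -EFinM lee_fin !mulr_ge0.
- exact: measurable_funeM.
- by apply: emeasurable_funD => //; exact: emeasurable_funD.
move=> x _; rewrite -!EFinM -!EFinD lee_fin indicE.
set N : R := (hits H x)%:R.
have [jN|Nj] := ltnP j (hits H x).
  rewrite mem_set//= -subr_ge0.
  have -> : (a ^+ 2 * N ^+ 2 + 1%:R + 2 * a * j%:R - 2 * a * N =
    (a * N - 1) ^+ 2 + 2 * a * j%:R)%R by ring.
  by rewrite addr_ge0 ?sqr_ge0// !mulr_ge0.
rewrite memNset ?addr0; last by rewrite /= ltnNge Nj.
rewrite (@le_trans _ _ (2 * a * j%:R)%R)//.
  by rewrite ler_wpM2l ?mulr_ge0// ler_nat.
by rewrite lerDr mulr_ge0// sqr_ge0.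
Qed.

Variable C : R.
Hypothesis C0 : (0 < C)%R.
Hypothesis mean_unbounded : forall M : R, exists H, (M <= mean H)%R.
Hypothesis corr : forall H,
  (Lam * correlation H <= C * mean H ^+ 2 + Lam * mean H)%R.

Let U j := \bigcup_H [set x | (j < hits H x)%N].

Let mU j : measurable (U j `&` Q).
Proof.
apply: measurableI => //; apply: bigcup_measurable => H _; exact: measurable_hits.
Qed.

(** For a stage of mean E, the inequality [measure_hits_ge] with the best a, together with [corr],
    gives u >= (E - j Lam)^2 Lam / (C E^2 + Lam E). The right-hand side tends to Lam / C as E
    grows. *)
Let U_ge j : (Lam / C)%:E <= mu (U j `&` Q).
Proof.
have fU : mu (U j `&` Q) \is a fin_num.
  by apply: fin_muI; apply: bigcup_measurable => H _; exact: measurable_hits.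
rewrite -(fineK fU) lee_fin; set u := fine _.
have u0 : (0 <= u)%R by rewrite fine_ge0.
have key H (a : R) : (0 <= a -> 2 * a * mean H <=
    a ^+ 2 * correlation H + u + 2 * a * j%:R * Lam)%R.
  move=> a0; have := measure_hits_ge H j a0.
  have le : mu ([set x | (j < hits H x)%N] `&` Q) <= u%:E.
    rewrite fineK//; apply: le_measure; rewrite ?inE//.
      by apply: measurableI => //; exact: measurable_hits.
    by apply: setSI => x jx; exists H.
  move=> h; rewrite -lee_fin (le_trans h)// !EFinD leeD2r// leeD2l//.
rewrite ler_pdivrMr//; rewrite leNgt; apply/negP => uC.
pose j' : R := j%:R%R.
have j'0 : (0 <= j')%R by [].
(* This size ensures E >= 1, E >= j Lam and E (Lam - u C) > 2 j Lam^2 + u Lam; the last inequality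
   contradicts the bound obtained at the end. *)
pose M := (1 + j' * Lam + (2 * j' * Lam ^+ 2 + u * Lam) / (Lam - u * C))%R.
have [H MH] := mean_unbounded M.
set E := mean H in MH.
have d0 : (0 < Lam - u * C)%R by rewrite subr_gt0.
have t0 : (0 <= (2 * j' * Lam ^+ 2 + u * Lam) / (Lam - u * C))%R.
  by apply: divr_ge0 (ltW d0); rewrite addr_ge0 ?mulr_ge0 ?sqr_ge0 ?(ltW Lam0).
have jL : (0 <= j' * Lam)%R by rewrite mulr_ge0// ltW.
have E1 : (1 <= E)%R by rewrite /M in MH; lra.
have Ej : (0 <= E - j' * Lam)%R by rewrite /M in MH; lra.
have EM : (2 * j' * Lam ^+ 2 + u * Lam < E * (Lam - u * C))%R.
  by rewrite -ltr_pdivrMr//; rewrite /M in MH; lra.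
pose P := (C * E ^+ 2 + Lam * E)%R.
have P0 : (0 < P)%R by rewrite /P addr_gt0// mulr_gt0 ?exprn_gt0//; lra.
(* This [a] maximizes 2 a (E - j Lam) - a^2 P / Lam. *)
pose a := ((E - j' * Lam) * Lam / P)%R.
have a0 : (0 <= a)%R by apply: divr_ge0 (ltW P0); apply: mulr_ge0 Ej (ltW Lam0).
have := key H a a0; rewrite -/E -/j'.
have cP : (correlation H <= P / Lam)%R by rewrite ler_pdivlMr// mulrC; exact: corr.
have {cP} c2 : (a ^+ 2 * correlation H <= a ^+ 2 * (P / Lam))%R.
  by rewrite ler_wpM2l ?sqr_ge0.
move=> h; have {h c2} : (2 * a * (E - j' * Lam) <= a ^+ 2 * (P / Lam) + u)%R.
  by lra.
have -> : (a ^+ 2 * (P / Lam) = a * (E - j' * Lam))%R.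
  by rewrite /a; field; rewrite !gt_eqF.
move=> h; have {h} : (a * (E - j' * Lam) <= u)%R by lra.
rewrite (_ : (a * (E - j' * Lam) = (E - j' * Lam) ^+ 2 * Lam / P)%R); last first.
  by rewrite /a; field; rewrite gt_eqF.
rewrite ler_pdivrMr// /P => h.
have pos : (0 < E * (E * (Lam - u * C) - (2 * j' * Lam ^+ 2 + u * Lam)))%R.
  by rewrite mulr_gt0 ?subr_gt0//; lra.
have jL3 : (0 <= j' ^+ 2 * Lam ^+ 3)%R by rewrite mulr_ge0 ?sqr_ge0// exprn_ge0// ltW.
move: h; apply/negP; rewrite -ltNge -subr_gt0.
have -> : ((E - j' * Lam) ^+ 2 * Lam - u * (C * E ^+ 2 + Lam * E) =
  E * (E * (Lam - u * C) - (2 * j' * Lam ^+ 2 + u * Lam)) + j' ^+ 2 * Lam ^+ 3)%R.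
  by ring.
by rewrite ltr_wpDr.
Qed.

(** The Kochen-Stone argument: the sets [U j] decrease with j and each has measure at least Lam / C
    in Q, so continuity from above passes the bound to their intersection. *)
Lemma measure_hits_unbounded :
  (Lam / C)%:E <= mu ([set x | forall j, exists H, (j < hits H x)%N] `&` Q).
Proof.
have -> : [set x | forall j, exists H, (j < hits H x)%N] `&` Q =
    \bigcap_j (U j `&` Q).
  apply/seteqP; split=> x.
    by move=> [xU xQ] j _; split => //; have [H jH] := xU j; exists H.
  move=> xU; split; last by have [] := xU 0%N Logic.I.
  by move=> j; have [[H _ jH] _] := xU j Logic.I; exists H.
have mcap : measurable (\bigcap_j (U j `&` Q)) by exact: bigcap_measurable.
have U0 : mu (U 0%N `&` Q) < +oo.
  by rewrite -ge0_fin_numE//; apply: fin_muI; apply: bigcup_measurable => H _;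
    exact: measurable_hits.
have ndU : nonincreasing_seq (fun j => U j `&` Q).
  move=> i j ij; apply/subsetPset; apply: setSI => x [H _ jH].
  by exists H => //=; exact: leq_ltn_trans jH.
have cvg := nonincreasing_cvg_mu U0 mU mcap ndU.
rewrite -(cvg_lim _ cvg)//.
by apply: lime_ge; [apply/cvg_ex; eexists; exact: cvg|exact: nearW].
Qed.

End kochen_stone.

(** * Totients *)

Lemma sum_dvdn_range d N : (0 < d)%N ->
  (\sum_(n < N) (d %| n.+1) = N %/ d)%N.
Proof.
move=> d0; elim: N => [|N IH]; first by rewrite big_ord0 div0n.
by rewrite big_ord_recr /= IH divnS// addnC.
Qed.

(** Pairs d | n with n <= N are counted with weight phi(d) in two ways, using that phi(d) summed
    over the divisors d of n is n. *)
Lemma sum_totient_mul_divn N :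
  (\sum_(d < N) totient d.+1 * (N %/ d.+1) = \sum_(n < N) n.+1)%N.
Proof.
transitivity (\sum_(d < N) \sum_(n < N) (totient d.+1 * (d.+1 %| n.+1)))%N.
  by apply: eq_bigr => d _; rewrite -big_distrr /= sum_dvdn_range.
rewrite exchange_big /=; apply: eq_bigr => n _.
rewrite -[RHS]sum_totient_dvd [RHS]big_mkcond [RHS]big_ord_recl /= add0n.
rewrite [RHS](big_ord_widen N (fun d => if d.+1 %| n.+1 then totient d.+1 else 0)%N)//.
rewrite [RHS]big_mkcond /=; apply: eq_bigr => d _.
case: (boolP (d.+1 %| n.+1)%N) => dn; rewrite ?muln1 ?muln0; last by case: ifP.
by rewrite ifT//; exact: dvdn_leq.
Qed.

Section totient_density.
Context (R : realType).

Definition totient_ratio (k : nat) : R := (totient k.+1)%:R / k.+1%:R.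

Lemma totient_ratio_ge0 k : 0 <= totient_ratio k.
Proof. by rewrite divr_ge0. Qed.

Lemma totient_leq n : (totient n <= n)%N.
Proof.
rewrite totient_count_coprime -[leqRHS]subn0 -[leqRHS]muln1 -sum_nat_const_nat.
by apply: leq_sum => d _; exact: leq_b1.
Qed.

Lemma totient_ratio_le1 k : totient_ratio k <= 1.
Proof. by rewrite ler_pdivrMr// mul1r ler_nat totient_leq. Qed.

(** As N / d >= floor(N / d), N times the sum is at least the sum of phi(d) floor(N / d), which is N
    (N + 1) / 2. *)
Lemma sum_totient_ratio N : N%:R / 2 <= \sum_(k < N) totient_ratio k.
Proof.
have [->|N0] := posnP N; first by rewrite big_ord0 mul0r.
have NR : (0 : R) < N%:R by rewrite ltr0n.
suff : N%:R * (N%:R / 2) <= N%:R * \sum_(k < N) totient_ratio k.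
  by rewrite ler_pM2l.
apply: (@le_trans _ _ (\sum_(n < N) n.+1)%N%:R).
  have -> : (\sum_(n < N) n.+1 = 'C(N.+1, 2))%N.
    by rewrite -triangular_sum big_nat_recl// add0n big_mkord.
  rewrite mulrA ler_pdivrMr// -natrM -natrM ler_nat.
  rewrite bin2 /= muln2 -[in leqRHS](odd_double_half (N.+1 * N)).
  by rewrite oddM /= andNb add0n half_double; nia.
rewrite -sum_totient_mul_divn natr_sum mulr_sumr; apply: ler_sum => d _.
rewrite natrM /totient_ratio mulrCA ler_wpM2l//.
by rewrite ler_pdivlMr// -natrM ler_nat leq_trunc_div.
Qed.

(** The left side is at most (N / 4)^(e + 1). On the right, the indices d <= N / 4 carry at most N /
    4 of the total N / 2 of the ratios; the others carry at least N / 4, each with a power at least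
    (N / 4)^e. *)
Lemma sum_totient_ratio_pow e N :
  \sum_(k < N) (4 ^+ e.+1)^-1 * k.+1%:R ^+ e <=
  \sum_(k < N) totient_ratio k * k.+1%:R ^+ e.
Proof.
rewrite -mulr_sumr.
have h1 : (4 ^+ e.+1)^-1 * \sum_(k < N) k.+1%:R ^+ e <= (N%:R / 4) ^+ e.+1 :> R.
  rewrite expr_div_n mulrC ler_pM2r ?invr_gt0 ?exprn_gt0//.
  have -> : N%:R ^+ e.+1 = \sum_(k < N) N%:R ^+ e :> R.
    by rewrite sumr_const card_ord exprSr mulr_natr.
  apply: ler_sum => k _; rewrite lerXn2r ?nnegrE// ler_nat; exact: ltn_ord.
apply: (le_trans h1).
(* For small k the left side is nonpositive because the ratio is at most 1; for the others the
   subtracted indicator vanishes. *)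
have pw (k : 'I_N) : (N%:R / 4) ^+ e * (totient_ratio k - (4 * k.+1 <= N)%N%:R)
    <= totient_ratio k * k.+1%:R ^+ e.
  have [kN|Nk] := leqP (4 * k.+1) N.
    rewrite (@le_trans _ _ 0)//.
      by rewrite mulr_ge0_le0 ?exprn_ge0 ?divr_ge0// subr_le0 totient_ratio_le1.
    by rewrite mulr_ge0 ?totient_ratio_ge0 ?exprn_ge0.
  rewrite subr0 mulrC ler_wpM2l ?totient_ratio_ge0// lerXn2r ?nnegrE ?divr_ge0//.
  by rewrite ler_pdivrMr// -natrM ler_nat mulnC ltnW.
apply: (@le_trans _ _ (\sum_(k < N)
    (N%:R / 4) ^+ e * (totient_ratio k - (4 * k.+1 <= N)%N%:R))); last exact: ler_sum.
rewrite -mulr_sumr exprSr ler_wpM2l ?exprn_ge0 ?divr_ge0// sumrB.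
have h2 : \sum_(k < N) (4 * k.+1 <= N)%N%:R <= N%:R / 4 :> R.
  rewrite ler_pdivlMr// -natr_sum -natrM ler_nat.
  suff -> : (\sum_(k < N) (4 * k.+1 <= N) = N %/ 4)%N by exact: leq_trunc_div.
  under eq_bigr do rewrite mulnC -leq_divRL//.
  rewrite -(@big_mkord _ _ _ N xpredT (fun k => (k < N %/ 4)%N : nat)) /=.
  rewrite (@big_cat_nat _ _ _ (N %/ 4)) ?leq_div//= big_nat.
  rewrite (eq_bigr (fun=> 1%N)); last by move=> i /andP[_ ->].
  rewrite -big_nat sum_nat_const_nat subn0 muln1 big_nat big1 ?addn0// => i /andP[].
  by rewrite leqNgt => /negbTE ->.
have := sum_totient_ratio N; lra.
Qed.

(** Summation by parts: against nonnegative nonincreasing weights, the domination of all partial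
    sums passes to the weighted sums. *)
Lemma abel_comparison (c d r : nat -> R) N :
  (forall k, 0 <= r k) -> (forall k, r k.+1 <= r k) ->
  (forall n, \sum_(k < n) d k <= \sum_(k < n) c k) ->
  \sum_(k < N) d k * r k <= \sum_(k < N) c k * r k.
Proof.
move=> r0 rd dc; rewrite -subr_ge0 -sumrB.
case: N => [|n]; first by rewrite big_ord0.
(* The induction needs this stronger lower bound, the gap of the partial sums times the last
   weight. *)
apply: (@le_trans _ _ ((\sum_(k < n.+1) c k - \sum_(k < n.+1) d k) * r n)).
  by rewrite mulr_ge0// subr_ge0.
elim: n => [|n IH]; first by rewrite !big_ord1 mulrBl.
rewrite [leRHS]big_ord_recr; apply: (le_trans _ (lerD IH (lexx _))).
rewrite -mulrBl.
rewrite [X in X - _]big_ord_recr [X in _ - X]big_ord_recr /=.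
rewrite opprD addrACA mulrDl lerD2r ler_wpM2l ?subr_ge0//.
exact: (dc n.+1).
Qed.

Lemma divergent_unbounded (u : nat -> R) : (forall k, 0 <= u k) ->
  ~ cvgn (series u) -> forall M, exists N, M <= \sum_(k < N) u k.
Proof.
move=> u0 ncv M; apply: contra_notP ncv => /forallNP bd.
apply: nondecreasing_is_cvgn.
  apply/nondecreasing_seqP => n; rewrite /series /= big_nat_recr//= lerDl.
  exact: u0.
exists M => _ [N _ <-]; rewrite /series /= big_mkord.
by apply/ltW; rewrite ltNge; apply/negP; exact: bd.
Qed.

(** Replacing the weight 1 by phi(d) / d keeps a monotone series divergent, at the cost of the
    factor 4^(e + 1) from [sum_totient_ratio_pow]. *)
Lemma totient_series_unbounded (r : nat -> R) e :
  (forall k, 0 <= r k) -> (forall k, r k.+1 <= r k) ->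
  ~ cvgn (series (fun k => k.+1%:R ^+ e * r k)) ->
  forall M, exists N, M <= \sum_(k < N) totient_ratio k * k.+1%:R ^+ e * r k.
Proof.
move=> r0 rd ncv M.
have [|N MN] := divergent_unbounded _ ncv (4 ^+ e.+1 * M).
  by move=> k; rewrite mulr_ge0 ?exprn_ge0.
exists N.
apply: le_trans (@abel_comparison (fun k => totient_ratio k * k.+1%:R ^+ e)
  (fun k => (4 ^+ e.+1)^-1 * k.+1%:R ^+ e) r N r0 rd (sum_totient_ratio_pow e)).
have {}MN : M <= (4 ^+ e.+1)^-1 * \sum_(k < N) k.+1%:R ^+ e * r k.
  by rewrite ler_pdivlMl ?exprn_gt0.
by rewrite (le_trans MN)// mulr_sumr; apply: ler_sum => k _; rewrite mulrA.
Qed.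

End totient_density.

(** * Several variables *)

(** The limsup set of the strips. Only finitely many q share a height, so infinitely many q amounts
    to unbounded heights. *)
Definition approximable (R : realType) (L : R) (r : nat -> R) m :
  set (euclidean R m) :=
  [set x | forall N : nat, exists q : 'rV[int]_m,
     (N < height q)%N /\ strip L (q ord0) (r (height q)) x].
Arguments approximable {R} L r m.

Lemma measurable_approximable (R : realType) (L : R) (r : nat -> R) m :
  measurable (approximable L r m).
Proof.
rewrite (_ : approximable L r m = \bigcap_N \bigcup_q
  (if (N < height q)%N then strip L (q ord0) (r (height q)) else set0)).
  apply: bigcapT_measurable => N; apply: countable_bigcupT_measurable => [|q];
    [exact: countableP|case: ifP => // _; exact: measurable_strip].
apply/seteqP; split=> x.
  by move=> xA N _; have [q [Nq xq]] := xA N; exists q => //; rewrite Nq.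
by move=> xA N; have [q _] := xA N Logic.I; case: ifP => // Nq xq; exists q.
Qed.

(** * A large family of pairwise non-parallel integer vectors *)

Section good_vectors.
Variables (k H : nat).

(* The first coordinate is the height, and its coprimality with the second one
   makes distinct good vectors non-parallel. *)
Definition good (f : {ffun 'I_k.+2 -> 'I_H.+1}) : bool :=
  [&& (0 < f ord0)%N, coprime (f ord0) (f (lift ord0 ord0)) &
      [forall i, (i != ord0) ==> (f i < f ord0)%N]].

Definition good_row (f : {ffun 'I_k.+2 -> 'I_H.+1}) : 'rV[int]_k.+2 :=
  \row_i (f i : nat)%:Z.

Lemma height_good_row f : good f -> height (good_row f) = f ord0.
Proof.
move=> /and3P[_ _ /forallP fle]; apply/eqP; rewrite eqn_leq; apply/andP; split.
  apply/bigmax_leqP => i _; rewrite mxE absz_nat.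
  by have [->//|i0] := eqVneq i ord0; have := fle i; rewrite i0 => /ltnW.
by apply: leq_trans (bigop.leq_bigmax ord0); rewrite mxE.
Qed.

(** If all minors vanish, coprimality makes each first coordinate divide the other. They are then
    equal, and proportionality becomes equality. *)
Lemma good_minor f g : good f -> good g -> f != g ->
  exists i j, (good_row f ord0 i * good_row g ord0 j -
               good_row f ord0 j * good_row g ord0 i != 0)%R.
Proof.
move=> /and3P[f0 cf _] /and3P[g0 cg _] fg; apply: contrapT => /forallNP nij.
move/negP: fg; apply; apply/eqP/ffunP => j.
have minor i : (f ord0 * g i = f i * g ord0)%N.
  have /forallNP /(_ i)/negP := nij ord0.
  rewrite negbK subr_eq0 !mxE => /eqP; rewrite -!PoszM => -[].
  by rewrite mulnC [RHS]mulnC => ->.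
have e0 : f ord0 = g ord0 :> nat.
  apply/eqP; rewrite eqn_dvd; apply/andP; split.
    rewrite -(Gauss_dvdr _ cf) -minor; exact: dvdn_mulr.
  rewrite -(Gauss_dvdr _ cg) mulnC minor; exact: dvdn_mull.
apply/val_inj => /=; have := minor j; rewrite mulnC e0.
by move/eqP; rewrite eqn_pmul2r// => /eqP.
Qed.

Lemma card_below a : (a <= H.+1)%N -> #|[pred b : 'I_H.+1 | (b < a)%N]| = a.
Proof.
move=> aH; rewrite -sum1_card (eq_bigl (fun b : 'I_H.+1 => (b < a)%N))//.
by rewrite -(big_ord_widen H.+1 (fun=> 1%N))// sum_nat_const card_ord muln1.
Qed.

Lemma card_coprime_below a : (a <= H.+1)%N ->
  #|[pred b : 'I_H.+1 | (b < a)%N && coprime a b]| = totient a.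
Proof.
move=> aH; rewrite -sum1_card totient_count_coprime big_mkord.
rewrite (eq_bigl (fun b : 'I_H.+1 => (b < a)%N && coprime a b))//.
rewrite big_mkcondr /= -(big_ord_widen H.+1 (fun b => if coprime a b then 1 else 0)%N)//.
Qed.

(** Once the height a is fixed the conditions decouple: phi(a) choices for the second coordinate and
    a choices for each of the k remaining ones. *)
Lemma card_good a : (0 < a)%N -> (a <= H)%N ->
  #|[pred f | good f & f ord0 == a :> nat]| = (totient a * a ^ k)%N.
Proof.
move=> a0 aH.
pose F (i : 'I_k.+2) : pred 'I_H.+1 :=
  if i == ord0 then pred1 (inord a)
  else if i == lift ord0 ord0 then [pred b : 'I_H.+1 | (b < a)%N && coprime a b]
  else [pred b : 'I_H.+1 | (b < a)%N].
have aE : (inord a : 'I_H.+1) = a :> nat by rewrite inordK.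
have -> : #|[pred f | good f & f ord0 == a :> nat]| = #|family F|.
  apply: eq_card => f; rewrite !inE /good; apply/idP/familyP.
    move=> /andP[/and3P[_ cf /forallP fle] /eqP f0] i; rewrite /F.
    have [->|i0] := eqVneq i ord0; first by rewrite inE -val_eqE /= aE f0.
    have := fle i; rewrite i0 f0 /= => fia.
    by case: eqVneq => [i1|_]; rewrite inE fia//= -f0 i1.
  move=> Ff; have /eqP f0 : f ord0 == a :> nat.
    by have := Ff ord0; rewrite /F eqxx inE => /eqP ->; rewrite aE.
  rewrite f0 eqxx a0 andbT /=; apply/andP; split.
    by have := Ff (lift ord0 ord0); rewrite /F; case: eqVneq => // _; rewrite eqxx inE => /andP[].
  apply/forallP => i; apply/implyP => i0; have := Ff i; rewrite /F (negbTE i0).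
  by case: ifP => _; rewrite inE => // /andP[].
have F0 : #|F ord0| = 1%N by rewrite /F eqxx card1.
have F1 : #|F (lift ord0 ord0)| = totient a by exact: card_coprime_below (leqW aH).
have FS (i : 'I_k) : #|F (lift ord0 (lift ord0 i))| = a.
  by exact: card_below (leqW aH).
rewrite card_family foldrE big_map big_enum /= 2!big_ord_recl F0 F1 mul1n.
congr (_ * _)%N; rewrite (eq_bigr (fun=> a)) ?prod_nat_const ?card_ord// => i _.
Qed.

Lemma sum_good (R : comNzRingType) (F : nat -> R) :
  \sum_(f | good f) F (f ord0) =
  \sum_(a < H) (totient a.+1 * a.+1 ^ k)%N%:R * F a.+1.
Proof.
rewrite (partition_big (fun f : {ffun 'I_k.+2 -> 'I_H.+1} => f ord0) xpredT)//=.
rewrite big_ord_recl big_pred0 ?add0r; last first.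
  by move=> f; apply/negbTE/negP => /andP[/and3P[f0 _ _] /eqP fE]; rewrite fE in f0.
apply: eq_bigr => a _; rewrite -(@card_good a.+1)//.
rewrite (eq_bigr (fun=> F a.+1)); last by move=> f /andP[_ /eqP ->].
by rewrite sumr_const mulr_natl.
Qed.

End good_vectors.

(** The diagonal gives the linear term; the off-diagonal products are completed to the square by
    adding the nonnegative terms e(f)^2. *)
Lemma pairwise_independent_correlation (R : realFieldType) (I : finType)
    (P : pred I) (e : I -> R) (e2 : I -> I -> R) (Lam : R) :
  (forall f, P f -> e2 f f = e f) ->
  (forall f g, P f -> P g -> f != g -> Lam * e2 f g = e f * e g) ->
  Lam * (\sum_(f | P f) \sum_(g | P g) e2 f g) <=
  (\sum_(f | P f) e f) ^+ 2 + Lam * \sum_(f | P f) e f.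
Proof.
move=> e2E indep; rewrite expr2 mulr_suml !mulr_sumr -big_split /=.
apply: ler_sum => f Pf; rewrite (bigD1 f Pf) /= [\sum_(i | P i) e i](bigD1 f Pf) /=.
rewrite e2E// 2!mulrDr mulr_sumr (eq_bigr (fun g => e f * e g)); last first.
  by move=> g /andP[Pg gf]; rewrite indep// eq_sym.
rewrite -mulr_sumr; have : 0 <= e f * e f by rewrite -expr2 sqr_ge0.
lra.
Qed.

(** * Full measure in at least two variables *)

Section groshev.
Context (R : realType) (k : nat) (L : R) (r : nat -> R).
Hypotheses (L0 : 0 < L) (r0 : forall a, (0 < a)%N -> 0 < r a).
Hypotheses (rL : forall a, (0 < a)%N -> r a <= L).
Hypothesis rd : forall a b, (0 < a)%N -> (a <= b)%N -> r b <= r a.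
Hypothesis divr : ~ cvgn (series (fun j => j.+1%:R ^+ k.+1 * r j.+1)).
Local Notation m := k.+2.
Local Notation mun := (nlebesgue_measure R m).
Local Notation Q := (@box R m (fun=> `[0%R, L[%classic)).

Let s H : seq 'rV[int]_m := [seq good_row f | f <- enum (@good k H)].

Let B (q : 'rV[int]_m) : set (euclidean R m) := strip L (q ord0) (r (height q)).

Let mB q : measurable (B q). Proof. exact: measurable_strip. Qed.

Let Lm0 : 0 < L ^+ m. Proof. exact: exprn_gt0. Qed.

Let fin A : measurable A -> mun (A `&` Q) \is a fin_num.
Proof.
have Qoo : (mun Q < +oo)%E by rewrite nlebesgue_cube// ltry.
by move=> mA; exact: fin_num_measure_setI mA (@measurable_cube R L m) Qoo.
Qed.

Let e q : R := fine (mun (B q `&` Q)).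

Let sum_s H (F : 'rV[int]_m -> R) :
  \sum_(q <- s H) F q = \sum_(f : {ffun 'I_m -> 'I_H.+1} | good f) F (good_row f).
Proof. by rewrite big_map big_enum_cond; apply: eq_bigl => f; rewrite andbT. Qed.

Let e_ge H (f : {ffun 'I_m -> 'I_H.+1}) : good f ->
  L ^+ k.+1 * r (f ord0) <= e (good_row f).
Proof.
move=> gf; have f0 : (0 < f ord0)%N by case/and3P: gf.
have := @strip_size R L L0 m (good_row f ord0) (r (height (good_row f))).
rewrite -/(B _) -(fineK (fin (mB _))) -/(e _) nlebesgue_cube//.
rewrite -!EFinM lee_fin height_good_row// => H1.
rewrite -(ler_pM2l L0) mulrA -exprS mulrC H1 ?r0 ?rL//.
by exists ord0; rewrite mxE; case: (f ord0 : nat) f0.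
Qed.

(** There are phi(a) a^k = (phi(a) / a) a^(k + 1) good vectors of height a, so the mean dominates a
    divergent series with totient weights. *)
Let mean_ge M : exists H, M <= mean mun Q s B H.
Proof.
have [N MN] : exists N, M / L ^+ k.+1 <=
    \sum_(j < N) totient_ratio R j * j.+1%:R ^+ k.+1 * r j.+1.
  apply: (@totient_series_unbounded R (fun j => r j.+1) k.+1) => //.
  - by move=> j; exact/ltW/r0.
  - by move=> j; exact: rd.
exists N; rewrite /mean sum_s.
apply: (@le_trans _ _ (\sum_(f : {ffun 'I_m -> 'I_N.+1} | good f) L ^+ k.+1 * r (f ord0)));
  last by apply: ler_sum => f; exact: e_ge.
rewrite -mulr_sumr sum_good -ler_pdivrMl ?exprn_gt0// mulrC (le_trans MN)//.
apply: ler_sum => j _; rewrite natrM natrX /totient_ratio.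
by rewrite exprS mulrA divfK ?pnatr_eq0.
Qed.

(** Distinct good vectors have a nonzero minor, hence independent strips; this is why the constant
    is 1. *)
Let corr H : L ^+ m * correlation mun Q s B H <=
  1 * mean mun Q s B H ^+ 2 + L ^+ m * mean mun Q s B H.
Proof.
have -> : mean mun Q s B H = \sum_(f : {ffun 'I_m -> 'I_H.+1} | good f) e (good_row f).
  exact: (sum_s H e).
have -> : correlation mun Q s B H = \sum_(f : {ffun 'I_m -> 'I_H.+1} | good f)
    \sum_(g : {ffun 'I_m -> 'I_H.+1} | good g)
      fine (mun (B (good_row f) `&` B (good_row g) `&` Q)).
  transitivity (\sum_(f : {ffun 'I_m -> 'I_H.+1} | good f)
      \sum_(q <- s H) fine (mun (B (good_row f) `&` B q `&` Q))).
    exact: (sum_s H (fun p => \sum_(q <- s H) fine (mun (B p `&` B q `&` Q)))).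
  apply: eq_bigr => f _.
  exact: (sum_s H (fun q => fine (mun (B (good_row f) `&` B q `&` Q)))).
rewrite mul1r; apply: pairwise_independent_correlation => [f gf|f g gf gg fg].
  by rewrite setIid.
have [i [j ij]] := good_minor gf gg fg.
have indep := @strip_independence R L L0 m _ _ (r (height (good_row f)))
  (r (height (good_row g))) i j ij.
have eE q : (e q)%:E = mun (B q `&` Q) by exact: fineK (fin (mB q)).
pose e2 := fine (mun (B (good_row f) `&` B (good_row g) `&` Q)).
have e2E : e2%:E = mun (B (good_row f) `&` B (good_row g) `&` Q).
  exact: fineK (fin (measurableI _ _ (mB _) (mB _))).
have E : ((L ^+ m)%:E * e2%:E = mun Q * mun (B (good_row f) `&` B (good_row g) `&` Q))%E.
  exact: (congr2 mule (esym (nlebesgue_cube L0 m)) e2E).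
have E' : ((e (good_row f))%:E * (e (good_row g))%:E =
    mun (B (good_row f) `&` Q) * mun (B (good_row g) `&` Q))%E.
  exact: (congr2 mule (eE _) (eE _)).
exact: (EFin_inj (etrans E (etrans indep (esym E')))).
Qed.

(** Otherwise all good vectors hit by x have height at most N, and their number, at any stage, is at
    most the number of good vectors of such heights. *)
Let hits_unbounded x :
  (forall j, exists H, (j < hits s B H x)%N) -> approximable L r m x.
Proof.
move=> xU N; apply: contrapT => /forallNP xN.
have [H] := xU (\sum_(a < N) totient a.+1 * a.+1 ^ k)%N.
apply/negP; rewrite -leqNgt -(ler_nat R) hitsE sum_s.
apply: (@le_trans _ _
    (\sum_(f : {ffun 'I_m -> 'I_H.+1} | good f) (f ord0 <= N)%N%:R)).
  apply: ler_sum => f gf; rewrite indicE.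
  case: leqP => Nf /=; first by case: (x \in _).
  rewrite memNset// => xf; apply: (xN (good_row f)); split => //.
  by rewrite height_good_row.
rewrite [leLHS](_ : _ = \sum_(a < H) (totient a.+1 * a.+1 ^ k)%N%:R * (a < N)%N%:R);
  last exact: (@sum_good k H R (fun a => (a <= N)%N%:R)).
rewrite natr_sum (big_ord_widen (H + N) (fun a => (totient a.+1 * a.+1 ^ k)%N%:R))
  ?leq_addl//.
rewrite (big_ord_widen (H + N)
  (fun a => (totient a.+1 * a.+1 ^ k)%N%:R * (a < N)%N%:R)) ?leq_addr//.
rewrite big_mkcond [leRHS]big_mkcond /=; apply: ler_sum => a _.
by case: ifP => _; case: (a < N)%N; rewrite ?mulr1 ?mulr0.
Qed.

(** With C = 1 the lower bound of [measure_hits_unbounded] is already the measure of the whole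
    cube. *)
Lemma groshev_full_measure : mun (approximable L r m `&` Q) = mun Q.
Proof.
have := @measure_hits_unbounded _ _ R mun Q (L ^+ m) (@measurable_cube R L m) Lm0
  (nlebesgue_cube L0 m) _ s B mB 1 ltr01 mean_ge corr.
rewrite divr1 -(nlebesgue_cube L0 m) => le1.
have mA : measurable (approximable L r m `&` Q).
  by apply: measurableI; [exact: measurable_approximable|exact: measurable_cube].
apply/le_anti/andP; split.
  by apply: le_measure; rewrite ?inE//; exact: measurable_cube.
apply: (le_trans le1); apply: le_measure; rewrite ?inE//; last first.
  by apply: setSI; exact: hits_unbounded.
apply: measurableI; last exact: measurable_cube.
exact: (@measurable_hits_unbounded _ _ R _ s B mB).
Qed.

End groshev.

(** * One variable *)

Lemma modn_eq_mul_coprime a b m n : coprime a b ->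
  (m * b = n * b %[mod a])%N -> (m = n %[mod a])%N.
Proof.
move=> cab; wlog nm : m n / (n <= m)%N => [wl|] h.
  by case: (leqP n m) => nm; [exact: wl|apply/esym/wl => //; exact: ltnW].
apply/eqP; rewrite eqn_mod_dvd// -(Gauss_dvdl _ cab) mulnBl -eqn_mod_dvd ?leq_mul//.
exact/eqP.
Qed.

(* The pairs are told apart by the pair (difference / g, p / (q / g)), where
   g = gcd q q': equal differences force p modulo q / g. *)
Lemma card_small_differences m n q q' K : (0 < q)%N -> (0 < q')%N -> (m <= q)%N ->
  (#|[pred u : 'I_m * 'I_n | (u.2 * q < u.1 * q' <= u.2 * q + K)%N]| <= K)%N.
Proof.
move=> q0 q'0 mq; pose g := gcdn q q'.
have g0 : (0 < g)%N by rewrite gcdn_gt0 q0.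
pose a := (q %/ g)%N; pose b := (q' %/ g)%N.
have qE : q = (a * g)%N by rewrite divnK// dvdn_gcdl.
have q'E : q' = (b * g)%N by rewrite divnK// dvdn_gcdr.
have a0 : (0 < a)%N by rewrite divn_gt0// dvdn_leq// dvdn_gcdl.
have cab : coprime a b.
  by rewrite /coprime -(eqn_pmul2r g0) muln_gcdl -qE -q'E mul1n.
pose P := [pred u : 'I_m * 'I_n | (u.2 * q < u.1 * q' <= u.2 * q + K)%N].
pose t (u : 'I_m * 'I_n) := (u.1 * b - u.2 * a)%N.
(* The pair is written as one number in base g; since t u > 0, the predecessor makes these numbers
   range below K. *)
pose h (u : 'I_m * 'I_n) := ((t u).-1 * g + u.1 %/ a)%N.
have Pt u : P u -> [/\ (0 < t u)%N, (u.1 * b = t u + u.2 * a)%N & (t u * g <= K)%N].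
  rewrite /P /= qE q'E !mulnA => /andP[]; rewrite ltn_pmul2r// => h1 h2.
  rewrite /t; split; [by rewrite subn_gt0|by rewrite subnK// ltnW|].
  by rewrite mulnBl leq_subLR.
have ug (u : 'I_m * 'I_n) : (u.1 %/ a < g)%N.
  by rewrite ltn_divLR// mulnC -qE (leq_trans (ltn_ord _)).
rewrite cardE -(size_map h) -[leqRHS](size_iota 0).
apply: uniq_leq_size; last first.
  move=> y /mapP[u]; rewrite mem_enum => /Pt[t0 _ tK] ->; rewrite mem_iota /= add0n.
  apply: leq_trans tK; rewrite /h -{2}(prednK t0) mulSn addnC ltn_add2r.
  exact: ug.
rewrite map_inj_in_uniq ?enum_uniq// => u v; rewrite !mem_enum => Pu Pv huv.
have [tu0 ut _] := Pt _ Pu; have [tv0 vt _] := Pt _ Pv.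
have tuv : t u = t v.
  have := congr1 (divn^~ g) huv; rewrite /h !divnMDl// !(divn_small (ug _)) !addn0.
  by move=> tE; rewrite -(prednK tu0) -(prednK tv0) tE.
have duv : (u.1 %/ a = v.1 %/ a)%N.
  by have := congr1 (modn^~ g) huv; rewrite /h !modnMDl !(modn_small (ug _)).
have ruv : (u.1 = v.1 %[mod a])%N.
  apply: (modn_eq_mul_coprime cab); rewrite ut vt tuv.
  by rewrite ![(t v + _)%N]addnC !modnMDl.
have e1 : u.1 = v.1 :> nat by rewrite (divn_eq u.1 a) duv ruv -divn_eq.
have e2 : u.2 = v.2 :> nat.
  apply/eqP; rewrite -(eqn_pmul2r a0); apply/eqP/(@addnI (t u)).
  by rewrite -ut e1 vt tuv.
rewrite [u]surjective_pairing [v]surjective_pairing.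
by rewrite (val_inj e1) (val_inj e2).
Qed.

(** Each sign of p q' - p' q is an instance of [card_small_differences], with K the integer part of
    M. *)
Lemma card_close_fractions (R : realType) q q' (M : R) : (0 < q)%N -> (0 < q')%N ->
  0 <= M ->
  \sum_(p < q) \sum_(p' < q')
     ((p * q' != p' * q)%N && (`|(p * q')%:R - (p' * q)%:R| < M))%:R <= 2 * M.
Proof.
move=> q0 q'0 M0.
have [K KM Kmax] : exists2 K : nat, K%:R <= M & forall n, n%:R < M -> (n <= K)%N.
  exists (Num.truncn M); first by rewrite truncn_le.
  by move=> j /ltW jM; rewrite truncn_ge_nat.
pose A := [pred u : 'I_q * 'I_q' | (u.2 * q < u.1 * q' <= u.2 * q + K)%N].
pose A' := [pred u : 'I_q' * 'I_q | (u.2 * q' < u.1 * q <= u.2 * q' + K)%N].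
have -> : 2 * M = M + M by ring.
have cA : (#|A|)%:R <= M.
  by rewrite (le_trans _ KM)// ler_nat card_small_differences.
have cA' : (#|A'|)%:R <= M.
  by rewrite (le_trans _ KM)// ler_nat card_small_differences.
apply: le_trans (lerD cA cA').
rewrite -!sum1_card !natr_sum [X in _ <= X + _]big_mkcond [X in _ <= _ + X]big_mkcond /=.
rewrite -(pair_bigA _ (fun p p' => if A (p, p') then 1%:R else 0)) /=.
rewrite -(pair_bigA _ (fun p p' => if A' (p, p') then 1%:R else 0)) /=.
rewrite [X in _ <= _ + X]exchange_big /= -big_split /=; apply: ler_sum => p _.
rewrite -big_split /=; apply: ler_sum => p' _.
case: (boolP (_ && _)) => [/andP[ne lt]|_]; last by rewrite mulr0n addr_ge0//; case: ifP.
move: ne; rewrite neq_ltn => /orP[] cmp.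
  have -> : (p * q' < p' * q <= p * q' + K)%N.
    rewrite cmp -leq_subLR; apply: Kmax; rewrite natrB; last exact: ltnW.
    by rewrite (le_lt_trans _ lt)// distrC ler_norm.
  by rewrite lerDr; case: ifP.
have -> : (p' * q < p * q' <= p' * q + K)%N.
  rewrite cmp -leq_subLR; apply: Kmax; rewrite natrB; last exact: ltnW.
  by rewrite (le_lt_trans _ lt)// ler_norm.
by rewrite lerDl; case: ifP.
Qed.

(** * Positive measure from reduced fractions *)

Section khintchine.
Context (R : realType) (L : R) (r : nat -> R).
Hypotheses (L0 : 0 < L) (r0 : forall a, (0 < a)%N -> 0 < r a).
Hypotheses (rL : forall a, (0 < a)%N -> r a <= L).
Hypothesis rd : forall a b, (0 < a)%N -> (a <= b)%N -> r b <= r a.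
Hypothesis divr : ~ cvgn (series (fun j => r j.+1)).
Local Notation mu := (@lebesgue_measure R).
Local Notation Q := (`[0%R, L[%classic : set (measurableTypeR R)).

(** Reduced fractions of [0, 1[, as pairs of numerator and denominator; zero occurs only as 0/1. *)
Definition fractions (N : nat) : seq (nat * nat) :=
  [seq (p, j.+1) | j <- index_iota 0 N,
                   p <- [seq p <- index_iota 0 j.+1 | coprime j.+1 p]].

Lemma mem_fractions N p q : (p, q) \in fractions N ->
  [/\ (p < q)%N, (q <= N)%N & coprime q p].
Proof.
move=> /allpairsPdep[j [p' [jN + [-> ->]]]]; move: jN; rewrite mem_filter !mem_index_iota.
by move=> jN /andP[cp pj].
Qed.

Lemma fractions_uniq N : uniq (fractions N).
Proof.
apply: allpairs_uniq_dep; first exact: iota_uniq.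
  by move=> j _; rewrite filter_uniq// iota_uniq.
by move=> [j p] [j' p'] _ _ /= [-> ->].
Qed.

Lemma sum_fractions (F : nat * nat -> R) N : \sum_(u <- fractions N) F u =
  \sum_(j < N) \sum_(p < j.+1 | coprime j.+1 p) F (p : nat, j.+1).
Proof.
rewrite big_allpairs_dep big_mkord; apply: eq_bigr => j _.
by rewrite big_filter big_mkord.
Qed.

Definition fraction_nbhd (u : nat * nat) : set (measurableTypeR R) :=
  [set x | `|x * u.2%:R - u.1%:R * L| < r u.2].
Local Notation B := fraction_nbhd.

Lemma fraction_nbhdE p q : (0 < q)%N -> B (p, q) =
  `](p%:R * L - r q) / q%:R, (p%:R * L + r q) / q%:R[%classic.
Proof.
move=> q0; have qR : (0 : R) < q%:R by rewrite ltr0n.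
apply/seteqP; split=> x; rewrite /B /= in_itv/= ltr_distl.
  by move=> /andP[? ?]; rewrite ltr_pdivrMr// ltr_pdivlMr//; apply/andP.
by rewrite ltr_pdivrMr// ltr_pdivlMr.
Qed.

Lemma measurable_fraction_nbhd u : measurable (B u).
Proof.
by apply: measurable_norm_lt; apply: measurable_funB => //; exact: measurable_funM.
Qed.

Let mB := measurable_fraction_nbhd.
Let mQ : measurable Q. Proof. by []. Qed.

Lemma measure_period : mu Q = L%:E.
Proof. by rewrite lebesgue_measure_itv/= lte_fin L0 oppr0 adde0. Qed.

Let fin A : measurable A -> mu (A `&` Q) \is a fin_num.
Proof.
have Qoo : (mu Q < +oo)%E by rewrite measure_period ltry.
by move=> mA; exact: fin_num_measure_setI mA mQ Qoo.
Qed.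

Let e u := fine (mu (B u `&` Q)).
Let e2 u v := fine (mu (B u `&` B v `&` Q)).

(** Only the right half of the interval is kept: it stays inside [0, L[ because p < q and r q <=
    L. *)
Let e_ge p q : (p < q)%N -> r q / q%:R <= e (p, q).
Proof.
move=> pq; have q0 : (0 < q)%N by case: q pq.
have qR : (0 : R) < q%:R by rewrite ltr0n.
rewrite /e -lee_fin fineK; last exact: fin.
have -> : (r q / q%:R)%:E = mu `[(p%:R * L / q%:R), ((p%:R * L + r q) / q%:R)[%classic.
  rewrite lebesgue_measure_itv/= lte_fin ltr_pM2r ?invr_gt0// ltrDl r0//.
  by rewrite -EFinB; congr EFin; field; rewrite gt_eqF.
apply: le_measure; rewrite ?inE//; first by apply: measurableI => //; exact: mB.
rewrite fraction_nbhdE// => x; rewrite /= !in_itv/= => /andP[x1 x2].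
rewrite x2 andbT; split; last first.
  apply/andP; split; first by rewrite (le_trans _ x1)// divr_ge0// mulr_ge0// ltW.
  rewrite (lt_le_trans x2)// ler_pdivrMr//.
  rewrite (@le_trans _ _ (p.+1%:R * L))//.
    by rewrite -natr1 mulrDl mul1r lerD2l rL.
  by rewrite mulrC ler_wpM2l ?(ltW L0)// ler_nat.
by rewrite (lt_le_trans _ x1)// ltr_pM2r ?invr_gt0// gtrBl r0.
Qed.

Let e2_le_l p q v : (0 < q)%N -> e2 (p, q) v <= 2 * (r q / q%:R).
Proof.
move=> q0; have qR : (0 : R) < q%:R by rewrite ltr0n.
rewrite /e2 -lee_fin fineK; last exact: fin (measurableI _ _ (mB _) (mB _)).
have -> : (2 * (r q / q%:R))%:E = mu (B (p, q)).
  rewrite fraction_nbhdE// lebesgue_measure_itv/= lte_fin ltr_pM2r ?invr_gt0//.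
  rewrite ifT; last by have := r0 q0; lra.
  by rewrite -EFinB; congr EFin; field; rewrite gt_eqF.
apply: le_measure; rewrite ?inE//; last by move=> x [[]].
by apply: measurableI => //; apply: measurableI; exact: mB.
Qed.

Let e2C u v : e2 u v = e2 v u. Proof. by rewrite /e2 [B u `&` _]setIC. Qed.

(** A common point x would give |p q' - p' q| L = |q (x q' - p' L) - q' (x q - p L)| < q r(q') + q'
    r(q). *)
Let e2_0 p q p' q' : (0 < q)%N -> (0 < q')%N ->
  (q'%:R * r q + q%:R * r q') / L <= `|(p * q')%:R - (p' * q)%:R| ->
  e2 (p, q) (p', q') = 0.
Proof.
move=> q0 q'0 far; rewrite /e2 (_ : B _ `&` B _ = set0) ?set0I ?measure0//.
apply/seteqP; split=> // x [] /= h1 h2.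
have qR : (0 : R) < q%:R by rewrite ltr0n.
have qR' : (0 : R) < q'%:R by rewrite ltr0n.
move: far; rewrite ler_pdivrMr//; apply/negP; rewrite -ltNge.
rewrite -[L in X in X < _](gtr0_norm L0) -normrM.
have -> : ((p * q')%:R - (p' * q)%:R) * L =
  q%:R * (x * q'%:R - p'%:R * L) - q'%:R * (x * q%:R - p%:R * L) by rewrite !natrM; ring.
rewrite (le_lt_trans (ler_normB _ _))// !normrM (gtr0_norm qR) (gtr0_norm qR').
by rewrite [ltRHS]addrC ltrD// ltr_pM2l.
Qed.

(** Majorant for the overlap of two distinct intervals: zero unless the fractions are close, and
    then the length of the shorter interval. *)
Let g (u v : nat * nat) : R :=
  ((u.1 * v.2 != v.1 * u.2)%N &&
   (`|(u.1 * v.2)%:R - (v.1 * u.2)%:R| < (v.2%:R * r u.2 + u.2%:R * r v.2) / L))%:R *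
  (2 * Num.min (r u.2 / u.2%:R) (r v.2 / v.2%:R)).

Let g_ge0 u v : (0 < u.2)%N -> (0 < v.2)%N -> 0 <= g u v.
Proof.
move=> u0 v0; apply: mulr_ge0 => //; apply: mulr_ge0 => //.
by rewrite le_min; apply/andP; split; apply: divr_ge0 => //; exact/ltW/r0.
Qed.

Let e2_le N u v : u \in fractions N -> v \in fractions N ->
  e2 u v <= (u == v)%:R * e u + g u v.
Proof.
case: u v => [p q] [p' q'] /mem_fractions[pq _ cpq] /mem_fractions[pq' _ cpq'].
have q0 : (0 < q)%N by case: q pq {cpq}.
have q'0 : (0 < q')%N by case: q' pq' {cpq'}.
have g0 : 0 <= g (p, q) (p', q') by exact: g_ge0.
have [-> |uv] := eqVneq (p, q) (p', q').
  rewrite mul1r /e2 setIid -/(e _) lerDl.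
  by rewrite /g /= eqxx mul0r.
rewrite mul0r add0r /g /=.
have [E|_] /= := eqVneq (p * q')%N (p' * q)%N.
  exfalso; move/negP: uv; apply; apply/eqP.
  have qq : q = q'.
    apply/eqP; rewrite eqn_dvd; apply/andP; split.
      by rewrite -(Gauss_dvdr _ cpq) E dvdn_mull.
    by rewrite -(Gauss_dvdr _ cpq') -E dvdn_mull.
  by move/eqP: E; rewrite qq eqn_pmul2r// => /eqP ->.
have [lt|ge] := ltP; last by rewrite e2_0// mul0r.
rewrite mul1r minr_pMr// le_min e2_le_l//=.
by rewrite e2C e2_le_l.
Qed.

(** At most 2 M pairs are close, with M = (q' r(q) + q r(q')) / L. In each term of M the minimum is
    bounded by the quotient whose denominator cancels, which leaves r(q) r(q'). *)
Let sum_g q q' : (0 < q)%N -> (0 < q')%N ->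
  \sum_(p < q) \sum_(p' < q') g (p : nat, q) (p' : nat, q') <= 8 / L * (r q * r q').
Proof.
move=> q0 q'0; have qR : (0 : R) < q%:R by rewrite ltr0n.
have qR' : (0 : R) < q'%:R by rewrite ltr0n.
have rq := ltW (r0 q0); have rq' := ltW (r0 q'0).
set M := (q'%:R * r q + q%:R * r q') / L.
have M0 : 0 <= M.
  by apply: divr_ge0 (ltW L0); rewrite addr_ge0// mulr_ge0// ltW// r0.
set mn := Num.min (r q / q%:R) (r q' / q'%:R).
have mn0 : 0 <= mn by rewrite le_min !divr_ge0//= ltW// r0.
have -> : \sum_(p < q) \sum_(p' < q') g (p : nat, q) (p' : nat, q') =
  (\sum_(p < q) \sum_(p' < q') ((p * q' != p' * q)%N &&
    (`|(p * q')%:R - (p' * q)%:R| < M))%:R) * (2 * mn).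
  by rewrite mulr_suml; apply: eq_bigr => p _; rewrite mulr_suml.
rewrite (@le_trans _ _ (2 * M * (2 * mn)))//.
  by rewrite ler_wpM2r ?mulr_ge0//; exact: card_close_fractions.
have h1 : mn * (q'%:R * r q) <= r q * r q'.
  rewrite (@le_trans _ _ (r q' / q'%:R * (q'%:R * r q)))//.
    by rewrite ler_wpM2r// ?mulr_ge0// ge_min lexx orbT.
  by rewrite mulrA divfK ?gt_eqF// mulrC.
have h2 : mn * (q%:R * r q') <= r q * r q'.
  rewrite (@le_trans _ _ (r q / q%:R * (q%:R * r q')))//.
    by rewrite ler_wpM2r// ?mulr_ge0// ge_min lexx.
  by rewrite mulrA divfK ?gt_eqF.
rewrite /M; set X := q'%:R * r q in h1 *; set Y := q%:R * r q' in h2 *.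
have -> : 2 * ((X + Y) / L) * (2 * mn) = 4 / L * (mn * X + mn * Y).
  by field; rewrite gt_eqF.
have -> : 8 / L * (r q * r q') = 4 / L * (r q * r q' + r q * r q').
  by field; rewrite gt_eqF.
by apply: ler_wpM2l; [exact: divr_ge0 (ltW L0)|exact: lerD].
Qed.

Let r_ge0 j : 0 <= r j.+1. Proof. exact/ltW/r0. Qed.

Let sum_ratio N : \sum_(j < N) totient_ratio R j * r j.+1 <= mean mu Q fractions B N.
Proof.
rewrite /mean sum_fractions; apply: ler_sum => j _.
rewrite (@le_trans _ _ (\sum_(p < j.+1 | coprime j.+1 p) r j.+1 / j.+1%:R))//;
  last by apply: ler_sum => p cp; apply: e_ge.
have -> : totient_ratio R j * r j.+1 = r j.+1 / j.+1%:R * (totient j.+1)%:R.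
  by rewrite /totient_ratio; ring.
rewrite sumr_const -[leRHS]mulr_natr; apply: ler_wpM2l; first exact: divr_ge0 (r_ge0 _) (ler0n _ _).
rewrite ler_nat totient_count_coprime big_mkord -sum1_card [leqRHS]big_mkcond /=.
apply: leq_sum => p _.
by case: (boolP (coprime j.+1 p)) => // cp; rewrite ifT.
Qed.

(** Summation by parts with the exponent 0 of [sum_totient_ratio_pow]: restricting to reduced
    fractions costs at most a factor 4. *)
Let sum_r N : \sum_(j < N) r j.+1 <= 4 * mean mu Q fractions B N.
Proof.
rewrite -ler_pdivrMl//; apply: le_trans (sum_ratio N).
have := @abel_comparison R (fun j => totient_ratio R j * j.+1%:R ^+ 0)
  (fun j => (4 ^+ 1)^-1 * j.+1%:R ^+ 0) (fun j => r j.+1) N r_ge0.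
under eq_bigr do rewrite expr0 mulr1 expr1.
under [X in _ -> _ -> _ <= X]eq_bigr do rewrite expr0 mulr1.
rewrite mulr_sumr; apply; first by move=> j; exact: rd.
by move=> N'; exact: sum_totient_ratio_pow.
Qed.

Let mean_unbounded M : exists N, M <= mean mu Q fractions B N.
Proof.
have [|j||N MN] := @totient_series_unbounded R (fun j => r j.+1) 0 _ _ _ M.
- exact: r_ge0.
- exact: rd.
- by under [X in series X]eq_fun do rewrite expr0 mul1r.
exists N; apply: (le_trans MN); apply: le_trans (sum_ratio N).
by apply: ler_sum => j _; rewrite expr0 mulr1.
Qed.

(** The diagonal is bounded by the mean. Off the diagonal [sum_g] contributes 8 and the square of
    [sum_r] contributes 4^2, whence 128. *)
Let corr N : L * correlation mu Q fractions B N <=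
  128 * mean mu Q fractions B N ^+ 2 + L * mean mu Q fractions B N.
Proof.
have -> : mean mu Q fractions B N = \sum_(u <- fractions N) e u by [].
have -> : correlation mu Q fractions B N =
  \sum_(u <- fractions N) \sum_(v <- fractions N) e2 u v by [].
have h1 : \sum_(u <- fractions N) \sum_(v <- fractions N) e2 u v <=
    \sum_(u <- fractions N) e u +
    \sum_(u <- fractions N) \sum_(v <- fractions N) g u v.
  rewrite -big_split /= big_seq_cond [leRHS]big_seq_cond.
  apply: ler_sum => u /andP[us _].
  rewrite (@le_trans _ _ (\sum_(v <- fractions N) ((u == v)%:R * e u + g u v)))//.
    rewrite big_seq_cond [leRHS]big_seq_cond.
    by apply: ler_sum => v /andP[vs _]; exact: (@e2_le N).
  rewrite big_split /= lerD2r -mulr_suml.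
  rewrite -[leRHS]mul1r ler_wpM2r ?fine_ge0//.
  have -> : \sum_(v <- fractions N) (u == v)%:R = (count_mem u (fractions N))%:R :> R.
    rewrite -sum1_count natr_sum [RHS]big_mkcond /=; apply: eq_bigr => v _.
    by rewrite eq_sym; case: (v == u).
  by rewrite count_uniq_mem ?fractions_uniq// us.
have h2 : \sum_(u <- fractions N) \sum_(v <- fractions N) g u v <=
    8 / L * (\sum_(j < N) r j.+1) ^+ 2.
  rewrite sum_fractions.
  rewrite (@le_trans _ _ (\sum_(j < N) \sum_(p < j.+1) \sum_(i < N) \sum_(p' < i.+1)
      g (p : nat, j.+1) (p' : nat, i.+1)))//.
    apply: ler_sum => j _; rewrite big_mkcond; apply: ler_sum => p _ /=.
    have gs : 0 <= \sum_(i < N) \sum_(p' < i.+1) g (p : nat, j.+1) (p' : nat, i.+1).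
      by apply: sumr_ge0 => i _; apply: sumr_ge0 => p' _; exact: g_ge0.
    case: ifP => // _; rewrite sum_fractions; apply: ler_sum => i _.
    rewrite big_mkcond; apply: ler_sum => p' _ /=.
    by case: ifP => // _; exact: g_ge0.
  rewrite expr2 mulr_suml mulr_sumr; apply: ler_sum => j _.
  rewrite exchange_big /= mulr_sumr mulr_sumr; apply: ler_sum => i _.
  exact: sum_g.
have h3 : (\sum_(j < N) r j.+1) ^+ 2 <= (4 * \sum_(u <- fractions N) e u) ^+ 2.
  have e0 : 0 <= \sum_(u <- fractions N) e u by apply: sumr_ge0 => u _; exact: fine_ge0.
  have R0 : 0 <= \sum_(j < N) r j.+1 by exact: sumr_ge0.
  by rewrite lerXn2r ?nnegrE ?mulr_ge0//; exact: (sum_r N).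
set E := \sum_(u <- fractions N) e u in h1 h3 *.
have h4 : L * (8 / L * (\sum_(j < N) r j.+1) ^+ 2) <= 128 * E ^+ 2.
  have -> : 128 * E ^+ 2 = 8 * (4 * E) ^+ 2 by ring.
  by rewrite mulrA [L * _]mulrC divfK ?gt_eqF// ler_wpM2l.
have := ler_wpM2l (ltW L0) (le_trans h1 (lerD (lexx _) h2)).
rewrite mulrDr; lra.
Qed.

Definition khintchine_set : set (measurableTypeR R) :=
  [set x | forall N : nat, exists p q : nat, (N < q)%N /\ B (p, q) x].

Lemma measurable_khintchine_set : measurable khintchine_set.
Proof.
rewrite (_ : khintchine_set = \bigcap_N \bigcup_(u in [set: nat * nat])
  (if (N < u.2)%N then B u else set0)).
  apply: bigcapT_measurable => N; apply: countable_bigcupT_measurable => [|u];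
    [exact: countableP|by case: ifP].
apply/seteqP; split=> x.
  by move=> xK N _; have [p [q [Nq xq]]] := xK N; exists (p, q) => //=; rewrite Nq.
by move=> xK N; have [[p q] _ /=] := xK N Logic.I; case: ifP => // Nq xq; exists p, q.
Qed.

Let hits_unbounded x :
  (forall j, exists N, (j < hits fractions B N x)%N) -> khintchine_set x.
Proof.
move=> xU N; apply: contrapT => /forallNP xN.
have [H] := xU (\sum_(j < N) j.+1)%N.
apply/negP; rewrite -leqNgt -(ler_nat R) hitsE sum_fractions.
rewrite (@le_trans _ _ (\sum_(j < H) \sum_(p < j.+1) (j < N)%N%:R))//.
  apply: ler_sum => j _; rewrite big_mkcond; apply: ler_sum => p _ /=.
  case: ifP => // _; rewrite indicE.
  case: ltnP => Nj /=; first by case: (_ \in _).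
  rewrite memNset// => xB; have /forallNP /(_ j.+1) := xN p; apply; split=> //.
rewrite natr_sum (big_ord_widen (H + N) (fun j => j.+1%:R)) ?leq_addl//.
rewrite (big_ord_widen (H + N) (fun j => \sum_(p < j.+1) (j < N)%N%:R)) ?leq_addr//.
rewrite big_mkcond [leRHS]big_mkcond /=; apply: ler_sum => j _.
rewrite sumr_const card_ord.
by case: ifP => _; case: (j < N)%N; rewrite ?mulr0n ?mul0rn ?mulr1n ?ler0n.
Qed.

Lemma khintchine_positive_measure :
  ((L / 128)%:E <= mu (khintchine_set `&` Q))%E.
Proof.
have mK : measurable (khintchine_set `&` Q).
  by apply: measurableI => //; exact: measurable_khintchine_set.
have := @measure_hits_unbounded _ _ R mu Q L mQ L0 measure_period _ fractions B mB
  128 _ mean_unbounded corr.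
move=> /(_ (ltr0Sn _ _))/le_trans; apply; apply: le_measure; rewrite ?inE//; last first.
  by apply: setSI; exact: hits_unbounded.
apply: measurableI => //.
exact: (@measurable_hits_unbounded _ _ R _ fractions B mB).
Qed.

End khintchine.

(** The zero-dimensional factor is a Dirac mass at the empty tuple, so the integrand is an
    indicator. *)
Lemma nlebesgue1E (R : realType) (A : set (euclidean R 1)) : measurable A ->
  nlebesgue_measure R 1 A =
  lebesgue_measure [set a : measurableTypeR R | A (tuple_cons (a, [tuple]))].
Proof.
move=> mA; rewrite nlebesgue_measureS.
have mS := measurable_section_head [tuple] mA; set S := [set a | _] in mS *.
transitivity (\int[@lebesgue_measure R]_a (\1_S a)%:E)%E; last first.
  by rewrite integral_indic// setIT.
by apply: eq_integral => a _; rewrite /= diracE indicE.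
Qed.

(** * From positive measure to full measure *)

Section khintchine_full.
Context (R : realType) (L : R) (r : nat -> R).
Hypotheses (L0 : 0 < L) (r0 : forall a, (0 < a)%N -> 0 < r a).
Hypotheses (rL : forall a, (0 < a)%N -> r a <= L).
Hypothesis rd : forall a b, (0 < a)%N -> (a <= b)%N -> r b <= r a.
Hypothesis divr : ~ cvgn (series (fun j => r j.+1)).
Hypothesis doubling : forall d, (0 < d)%N -> exists2 K : R, 0 < K &
  forall q, (0 < q)%N -> r q <= K * r (d * q)%N.
Local Notation mu := (@lebesgue_measure R).
Local Notation Q := (`[0%R, L[%classic : set (measurableTypeR R)).

(* Allowing every constant 1 / (c + 1) makes the set invariant under all
   translations by rational multiples of L. *)
Definition all_scales : set (measurableTypeR R) :=
  [set x | forall c N : nat, exists (p : int) (q : nat),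
     (N < q)%N /\ `|x * q%:R - p%:~R * L| < r q / c.+1%:R].
Local Notation W := all_scales.

Lemma measurable_all_scales : measurable W.
Proof.
rewrite (_ : W = \bigcap_c \bigcap_N \bigcup_(u in [set: int * nat])
  (if (N < u.2)%N then
    [set x | `|x * u.2%:R - u.1%:~R * L| < r u.2 / c.+1%:R] else set0)).
  apply: bigcapT_measurable => c; apply: bigcapT_measurable => N.
  apply: countable_bigcupT_measurable => [|u]; first exact: countableP.
  case: ifP => // _; apply: measurable_norm_lt.
  by apply: measurable_funB => //; exact: measurable_funM.
apply/seteqP; split=> x.
  move=> xW c _ N _; have [p [q [Nq xq]]] := xW c N.
  by exists (p, q) => //=; rewrite Nq.
move=> xW c N; have [[p q] _ /=] := xW c Logic.I N Logic.I.
by case: ifP => // Nq xq; exists p, q.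
Qed.

Let mQ : measurable Q. Proof. by []. Qed.

Let scaled c : nat -> R := fun a => r a / c.+1%:R.

(** The bound L / 128 does not depend on the constant 1 / (c + 1), and the sets [K c] decrease with
    c, so it survives in their intersection. *)
Let all_scales_measure : ((L / 128)%:E <= mu (W `&` Q))%E.
Proof.
pose K c := khintchine_set L (scaled c) `&` Q.
have mK c : measurable (K c) by apply: measurableI => //; exact: measurable_khintchine_set.
have KW : \bigcap_c K c `<=` W `&` Q.
  move=> x xK; split; last by have [] := xK 0%N Logic.I.
  by move=> c N; have [/(_ N)[p [q [Nq xq]]] _] := xK c Logic.I; exists p, q.
have mcap : measurable (\bigcap_c K c) by exact: bigcapT_measurable.
have mWQ : measurable (W `&` Q) by apply: measurableI => //; exact: measurable_all_scales.
apply: (@le_trans _ _ (mu (\bigcap_c K c))); last by apply: le_measure; rewrite ?inE.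
have K0 : (mu (K 0%N) < +oo)%E.
  apply: (@le_lt_trans _ _ (mu Q)); last by rewrite measure_period// ltry.
  by apply: le_measure; rewrite ?inE; [exact: mK|exact: mQ|exact: subIsetr].
have ndK : nonincreasing_seq K.
  move=> i j ij; apply/subsetPset; apply: setSI => x xj N.
  have [p [q [Nq xq]]] := xj N; exists p, q; split => //.
  rewrite /fraction_nbhd /= in xq *; apply: (lt_le_trans xq).
  have rq : 0 <= r q by apply/ltW/r0; exact: leq_trans Nq.
  by rewrite /scaled ler_wpM2l// lef_pV2 ?posrE// ler_nat ltnS.
have cvg := nonincreasing_cvg_mu K0 mK mcap ndK.
rewrite -(cvg_lim _ cvg)//.
apply: lime_ge; first by apply/cvg_ex; eexists; exact: cvg.
apply: nearW => c; apply: khintchine_positive_measure => //.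
- by move=> a a0; rewrite divr_gt0// r0.
- move=> a a0; rewrite (le_trans _ (rL a0))// ler_pdivrMr//.
  by apply: ler_peMr; [exact/ltW/r0|rewrite ler1n].
- by move=> a b a0 ab; rewrite ler_wpM2r// rd.
- apply: contra_not divr => /(@is_cvg_seriesZ _ _ c.+1%:R).
  rewrite (_ : _ *: _ = fun j => r j.+1)//; apply/funext => j.
  by change (c.+1%:R * (r j.+1 / c.+1%:R) = r j.+1); rewrite mulrC divfK ?pnatr_eq0.
Qed.

(** An approximation of x with denominator q gives one of the translate with denominator d q; the
    error grows by d, and [doubling] compares r(q) with r(d q). *)
Let all_scales_shift (d : nat) (b : int) x : (0 < d)%N -> W x ->
  W (x + b%:~R * (L / d%:R)).
Proof.
move=> d0 xW c N; have [K K0 rK] := doubling d0.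
have dR : (0 : R) < d%:R by rewrite ltr0n.
(* Since [c'] + 1 > d K (c + 1), the scale [c'] absorbs both the factor d and the doubling
   constant. *)
pose c' := Num.truncn (d%:R * K * c.+1%:R).
have [p [q [Nq xq]]] := xW c' N.
have q0 : (0 < q)%N by exact: leq_trans Nq.
exists (d%:Z * p + q%:Z * b), (d * q)%N; split.
  by rewrite (leq_trans Nq)// leq_pmull.
have -> : (x + b%:~R * (L / d%:R)) * (d * q)%:R - (d%:Z * p + q%:Z * b)%:~R * L =
    d%:R * (x * q%:R - p%:~R * L).
  by rewrite natrM intrD !intrM -!pmulrn; field; rewrite gt_eqF.
rewrite normrM (gtr0_norm dR).
rewrite (@lt_le_trans _ _ (d%:R * (r q / c'.+1%:R)))//; first by rewrite ltr_pM2l.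
rewrite ler_pdivlMr// mulrA mulrAC ler_pdivrMr//.
have rdq : 0 < r (d * q)%N by rewrite r0// muln_gt0 d0.
rewrite (@le_trans _ _ (d%:R * (K * r (d * q)%N) * c.+1%:R))//.
  by rewrite ler_wpM2r// ler_wpM2l// rK.
rewrite (_ : _ * _ = r (d * q)%N * (d%:R * K * c.+1%:R)); last by ring.
by rewrite ler_wpM2l ?(ltW rdq)//; apply/ltW/truncnS_gt.
Qed.

Let all_scales_shift_iff (d : nat) (b : int) x : (0 < d)%N ->
  W (x + b%:~R * (L / d%:R)) <-> W x.
Proof.
move=> d0; split; last exact: all_scales_shift.
move=> /(all_scales_shift (- b) d0); congr W.
by rewrite rmorphN /= mulNr addrK.
Qed.

Let cell (d : nat) (b : int) : set (measurableTypeR R) :=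
  `[b%:~R * (L / d%:R), (b + 1)%:~R * (L / d%:R)[%classic.

Let all_scales_cell d b : (0 < d)%N ->
  mu (W `&` cell d b) = mu (W `&` cell d 0).
Proof.
move=> d0; rewrite -[RHS](lebesgue_measure_shift (- (b%:~R * (L / d%:R)))); last first.
  by apply: measurableI; [exact: measurable_all_scales|exact: measurable_itv].
congr (mu _); rewrite preimage_setI; congr setI; apply/seteqP; split => x /=.
- by move=> xW; rewrite -mulNr -rmorphN; exact: (all_scales_shift _ d0 xW).
- by rewrite -mulNr -rmorphN => /(all_scales_shift_iff _ _ d0).
- rewrite /cell /= !in_itv/= !rmorphD /= mul0r add0r mul1r mulrDl mul1r => /andP[? ?].
  by apply/andP; split; lra.
- rewrite /cell /= !in_itv/= !rmorphD /= mul0r add0r mul1r mulrDl mul1r => /andP[? ?].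
  by apply/andP; split; lra.
Qed.

(** The d cells of length L / d that cover a period meet W in equal measure, so each carries at
    least the fraction 1 / d of L / 128. *)
Let all_scales_cell_ge d b : (0 < d)%N ->
  ((L / 128 / d%:R)%:E <= mu (W `&` cell d b))%E.
Proof.
move=> d0; rewrite all_scales_cell//.
have dR : (0 : R) < d%:R by rewrite ltr0n.
have mWc b' : measurable (W `&` cell d b').
  by apply: measurableI; [exact: measurable_all_scales|exact: measurable_itv].
have le : (mu (W `&` Q) <= \sum_(i < d) mu (W `&` cell d i%:Z))%E.
  apply: le_trans (@Boole_inequality _ _ _ mu (fun i => W `&` cell d i%:Z) d _); last by [].
  apply: le_measure; rewrite ?inE.
  - by apply: measurableI => //; exact: measurable_all_scales.
  - by apply: bigsetU_measurable.
  move=> x [xW]; rewrite /= in_itv/= => /andP[x0 xL].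
  pose i := Num.truncn (x / (L / d%:R)).
  have Ld : 0 < L / d%:R by rewrite divr_gt0.
  have q0 : 0 <= x / (L / d%:R) by rewrite divr_ge0// ltW.
  have id : (i < d)%N.
    by rewrite /i truncn_lt_nat// ltr_pdivrMr// mulrC divfK ?gt_eqF.
  rewrite -(bigcup_mkord d (fun i => W `&` cell d i%:Z)); exists i => //; split => //.
  rewrite /cell /= in_itv/=; have /andP[] := truncn_itv q0; rewrite -/i.
  rewrite ler_pdivlMr// ltr_pdivrMr// => h1 h2; apply/andP; split => //.
  by move: h2; rewrite -natr1 intrD -pmulrn.
have {}le : ((L / 128)%:E <= d%:R%:E * mu (W `&` cell d 0))%E.
  apply: (le_trans all_scales_measure); apply: (le_trans le).
  have finW : mu (W `&` cell d 0) \is a fin_num.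
    rewrite ge0_fin_numE; last exact: measure_ge0.
    apply: (@le_lt_trans _ _ (mu (cell d 0))).
      by apply: le_measure; rewrite ?inE; [exact: mWc|exact: measurable_itv|exact: subIsetr].
    by rewrite lebesgue_measure_itv/=; case: ifP => _; rewrite ?ltry// -EFinB ltry.
  under eq_bigr do rewrite all_scales_cell// -(fineK finW).
  by rewrite sumEFin sumr_const card_ord -(fineK finW) -EFinM mulr_natl.
by rewrite EFinM muleC lee_pdivrMl.
Qed.

(** With d = floor(L / rho) + 1 the cells have length in [rho / 2, rho[, so the cell containing x
    lies in the ball. *)
Let all_scales_ball x rho : 0 < rho -> rho <= L ->
  ((rho / 256)%:E <= mu (W `&` ball x rho))%E.
Proof.
move=> rho0 rhoL; pose d := (Num.truncn (L / rho)).+1.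
have dR : (0 : R) < d%:R by rewrite ltr0n.
have Lrho0 : 0 <= L / rho by rewrite divr_ge0// ltW.
have Ld1 : L / d%:R < rho.
  by rewrite ltr_pdivrMr// mulrC -ltr_pdivrMr// truncnS_gt.
have Ld2 : rho / 2 <= L / d%:R.
  rewrite ler_pdivlMr// mulrAC ler_pdivrMr// -ler_pdivlMl//.
  rewrite /d -natr1; have := truncn_le (L / rho); rewrite Lrho0 => h.
  have : 1 <= L / rho by rewrite ler_pdivlMr// mul1r.
  by rewrite [rho^-1 * _]mulrC mulrAC; lra.
have Ld0 : 0 < L / d%:R by rewrite divr_gt0.
pose b := Num.floor (x / (L / d%:R)).
have cb : cell d b `<=` ball x rho.
  move=> y; rewrite /cell /= in_itv/= => /andP[y1 y2].
  have /andP[] := floor_itv (x / (L / d%:R)); rewrite -/b.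
  rewrite ler_pdivlMr// ltr_pdivrMr// => x1 x2.
  rewrite /ball/= ltr_norml; move: y2 x2; rewrite intrD mulrDl mul1r => y2 x2.
  by apply/andP; split; lra.
apply: (@le_trans _ _ (mu (W `&` cell d b))).
  have d0 : (0 < d)%N by [].
  apply: le_trans (all_scales_cell_ge b d0); rewrite lee_fin.
  have -> : L / 128 / d%:R = L / d%:R / 128 by rewrite mulrAC.
  by lra.
apply: le_measure; rewrite ?inE.
- by apply: measurableI; [exact: measurable_all_scales|exact: measurable_itv].
- by apply: measurableI; [exact: measurable_all_scales|exact: measurable_ball].
- exact: setIS.
Qed.

(** At a density point the proportion of W in small balls tends to the indicator of W. By
    [all_scales_ball] this proportion is at least (rho / 256) / (2 rho) = 1 / 512, so the limit is
    not 0. *)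
Lemma ae_all_scales : {ae mu, forall x, W x}.
Proof.
have := lebesgue_density measurable_all_scales.
apply: filter_app; first exact: (ae_filter_ringOfSetsType mu).
apply: aeW => /= x xd; apply: contrapT => nWx.
suff : ((1 / 512)%:E <= (\1_W x)%:E :> \bar R)%E.
  by rewrite indicE memNset// mulr0n lee_fin; lra.
rewrite -(cvg_lim _ xd)//; apply: lime_ge; first by apply/cvg_ex; eexists; exact: xd.
near=> rho.
have rho0 : 0 < rho by near: rho; exact: nbhs_right_gt.
have rhoL : rho <= L by near: rho; exact: nbhs_right_le.
rewrite lebesgue_measure_ball; last exact: ltW.
rewrite inver ifF; last by apply/negbTE; rewrite mulrn_eq0/= gt_eqF.
rewrite muleC -lee_pdivrMl ?invr_gt0 ?mulrn_wgt0//.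
apply: le_trans (all_scales_ball x rho0 rhoL).
by rewrite -EFinM lee_fin invrK; lra.
Unshelve. all: by end_near. Qed.

Lemma all_scales_approximable a :
  W a -> approximable L r 1 (tuple_cons (a, [tuple])).
Proof.
move=> aW N; have [p [q [Nq aq]]] := aW 0%N N.
have hq : height (\row_(_ < 1) q%:Z) = q by rewrite /height big_ord1 mxE.
exists (\row_(_ < 1) q%:Z); rewrite hq; split=> //; exists p.
by move: aq; rewrite divr1 /lin big_ord1 mxE /= mulrC pmulrn.
Qed.

Lemma khintchine_full_measure :
  nlebesgue_measure R 1 (approximable L r 1 `&` box (fun=> Q)) =
  nlebesgue_measure R 1 (box (fun=> Q)).
Proof.
have mA : measurable (approximable L r 1 `&` box (fun=> Q)).
  by apply: measurableI; [exact: measurable_approximable|exact: measurable_cube].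
have mB : measurable (@box R 1 (fun=> Q)) by exact: measurable_cube.
rewrite (nlebesgue1E mA) (nlebesgue1E mB).
have mW := measurable_all_scales.
have [N [mN N0 WN]] := ae_all_scales.
apply/le_anti/andP; split.
  apply: le_measure; rewrite ?inE; [exact: measurable_section_head|exact: measurable_section_head|].
  by move=> a [].
set SB := [set a | _]; set SA := [set a | _].
have mSA : measurable SA by exact: measurable_section_head.
have mSB : measurable SB by exact: measurable_section_head.
apply: (@le_trans _ _ (mu (SA `|` N))).
  apply: le_measure; rewrite ?inE//; first exact: measurableU.
  move=> a aB; case: (pselect (W a)) => [aW|nW]; last by right; exact: WN.
  by left; split => //; exact: all_scales_approximable.
by apply: le_trans (measureU2 _ mSA mN) _; rewrite [X in (_ + X)%E]N0 adde0.
Qed.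

End khintchine_full.

(** * The divergent case *)

Lemma approximable_full_measure (R : realType) (L : R) (r : nat -> R) k :
  0 < L -> (forall a, (0 < a)%N -> 0 < r a) ->
  (forall a, (0 < a)%N -> r a <= L) ->
  (forall a b, (0 < a)%N -> (a <= b)%N -> r b <= r a) ->
  (forall d, (0 < d)%N -> exists2 K : R, 0 < K &
    forall q, (0 < q)%N -> r q <= K * r (d * q)%N) ->
  ~ cvgn (series (fun j => j.+1%:R ^+ k * r j.+1)) ->
  nlebesgue_measure R k.+1 (approximable L r k.+1 `&` box (fun=> `[0, L[%classic)) =
  nlebesgue_measure R k.+1 (box (fun=> `[0, L[%classic)).
Proof.
move=> L0 r0 rL rd dbl; case: k => [|k] ndiv; last exact: groshev_full_measure.
apply: khintchine_full_measure => //; apply: contra_not ndiv.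
rewrite (_ : (fun j => j.+1%:R ^+ 0 * r j.+1) = (fun j => r j.+1))//.
by apply/funext => j; rewrite expr0 mul1r.
Qed.

Lemma unbounded_height_infinite n (A : set 'rV[int]_n) :
  (forall N, exists2 q, A q & (N < height q)%N) -> infinite_set A.
Proof.
move=> Aoo /finite_seqP[s sE].
have [q Aq] := Aoo (\max_(q <- s) height q)%N.
apply/negP; rewrite -leqNgt; apply: leq_bigmax_seq => //.
by move: Aq; rewrite sE.
Qed.

Lemma height_ge n (q : 'rV[int]_n) i : (`|q ord0 i| <= height q)%N.
Proof. exact: bigop.leq_bigmax. Qed.

Section measure_full.
Context d (T : measurableType d) (R : realType) (mu : {measure set T -> \bar R}).

(** A set that is full in [A] misses only a null part of it. This carries full measure from [0, L[^m
    to the unit cube. *)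
Lemma measure_setI_full (U A B : set T) :
  measurable U -> measurable A -> measurable B -> U `<=` A ->
  (mu A < +oo)%E -> mu (B `&` A) = mu A -> mu (B `&` U) = mu U.
Proof.
move=> mU mA mB UA Aoo full; have AB0 : mu (A `\` B) = 0%E.
  have AB : mu (A `&` B) = mu A by rewrite setIC.
  by rewrite measureD// [X in (_ - X)%E]AB subee// ge0_fin_numE.
have UB0 : mu (U `\` B) = 0%E.
  apply: (subset_measure0 _ _ _ AB0); [exact: measurableD|exact: measurableD|].
  exact: setSD.
by rewrite [RHS](measureDI mu mU mB) [X in (X + _)%E]UB0 add0e setIC.
Qed.

End measure_full.

Section divergence.
Context (R : realType) (l : nat) (psi : nat -> R).
Local Notation m := l.+1.
Hypothesis psi0 : forall k, (0 < k)%N -> 0 < psi k.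
Hypothesis ndiv : ~ cvgn (series (fun k => k.+1%:R ^+ l * psi k.+1)).
Hypothesis slow : slowly_decreasing psi.

Let psid a b : (0 < a)%N -> (a <= b)%N -> psi b <= psi a.
Proof. by case: slow => h _; exact: h. Qed.

(** Slow decrease with c = 1 / d; the case d = 1 is separate because c < 1 is required. *)
Let doubling d : (0 < d)%N -> exists2 K : R, 0 < K &
  forall q, (0 < q)%N -> psi q <= K * psi (d * q)%N.
Proof.
case: d => [//|[_|d _]].
  by exists 1 => // q _; rewrite mul1n mul1r.
have [_ /(_ (d.+2%:R^-1))] := slow.
case; first by rewrite invr_gt0 ltr0n /= invf_lt1 ?ltr0n// ltr1n.
move=> K K1 HK; exists K; first exact: lt_trans K1.
move=> q q0; apply: HK => //; rewrite ?muln_gt0//.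
by rewrite natrM mulrA mulVf ?mul1r// pnatr_eq0.
Qed.

Let unit_box := @box R m (fun=> `[0, 1[%classic).

(** For almost every x of the unit cube, each q with q.x near L Z lifts to an integer vector that is
    a solution at (t, x). *)
Lemma V_section_measure t : 0 < t <= 1 ->
  (1 <= nlebesgue_measure R m [set x | V m.+1 psi (tuple_cons (t, x))])%E.
Proof.
move=> /andP[t0 t1].
(* M > 1 / t makes L >= 1, so that [0, L[^m contains the unit cube. *)
pose M := (Num.truncn t^-1).+1.
have MR : (0 : R) < M%:R by rewrite ltr0n.
pose L := M%:R * t.
have L1 : 1 <= L.
  by rewrite /L -ler_pdivrMr// mul1r ltW// truncnS_gt.
have L0 : 0 < L by exact: lt_le_trans L1.
(* From |p L| <= m |q| + 1 <= (m + 1) |q| and L = M t, this choice gives |p M| <= C |q|. *)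
pose C := (Num.truncn (m.+1%:R / t)).+1.
have Ct : m.+1%:R <= C%:R * t.
  by rewrite -ler_pdivrMr// ltW// truncnS_gt.
(* [kap] <= 1 keeps [r a] below psi(C a), and [kap] psi(1) <= 1 keeps [r a] below 1, hence below
   L. *)
pose kap := (1 + psi 1%N)^-1.
have psi1 : 0 < psi 1%N by exact: psi0.
have kap0 : 0 < kap by rewrite invr_gt0 addr_gt0.
have kap1 : kap * psi 1%N <= 1.
  by rewrite mulrC ler_pdivrMr ?addr_gt0// mul1r lerDr.
have kapl : kap <= 1.
  by rewrite invf_le1; [rewrite lerDl ltW|rewrite addr_gt0].
pose r a := kap * psi (C * a)%N.
have r0 a : (0 < a)%N -> 0 < r a by move=> a0; rewrite mulr_gt0// psi0// muln_gt0.
have r1 a : (0 < a)%N -> r a <= 1.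
  by move=> a0; rewrite (le_trans _ kap1)// ler_wpM2l ?(ltW kap0)// psid// muln_gt0.
have rpsi a : (0 < a)%N -> r a <= psi (C * a)%N.
  move=> a0; rewrite -[leRHS]mul1r ler_wpM2r//.
  by apply/ltW/psi0; rewrite muln_gt0.
have full : nlebesgue_measure R m (approximable L r m `&` box (fun=> `[0, L[%classic)) =
    nlebesgue_measure R m (box (fun=> `[0, L[%classic)).
  apply: approximable_full_measure => //.
  - by move=> a a0; exact: le_trans (r1 a a0) L1.
  - move=> a b a0 ab; rewrite ler_wpM2l ?(ltW kap0)// psid ?muln_gt0//.
    by rewrite leq_mul2l ab orbT.
  - move=> d d0; have [K K0 HK] := doubling d0; exists K => // q q0.
    by rewrite mulrCA ler_wpM2l ?(ltW kap0)// mulnCA HK// muln_gt0.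
  (* Doubling with the factor C bounds psi(q) by (K / kap) r(q), so convergence of the series of r
     would contradict [ndiv]. *)
  have [K K0 HK] := doubling (ltn0Sn (Num.truncn (m.+1%:R / t))).
  apply: contra_not ndiv => /(@is_cvg_seriesZ _ _ (K / kap)).
  apply: series_le_cvg.
  - by move=> j; rewrite mulr_ge0 ?exprn_ge0// ltW// psi0.
  - by move=> j; rewrite mulr_ge0 ?divr_ge0 ?(ltW K0) ?(ltW kap0)// mulr_ge0 ?exprn_ge0//
      ltW// r0.
  move=> j; change (j.+1%:R ^+ l * psi j.+1 <= K / kap * (j.+1%:R ^+ l * r j.+1)).
  rewrite mulrCA ler_wpM2l ?exprn_ge0// /r mulrA divfK ?gt_eqF//.
  exact: HK.
have sub x : unit_box x -> approximable L r m x -> V m.+1 psi (tuple_cons (t, x)).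
  move=> x01 xA; split.
    move=> i; case: (unliftP ord0 i) => [j|] ->; last by rewrite /= (ltW t0) t1.
    by rewrite tnthS; have := x01 j; rewrite /= in_itv/= => /andP[-> /ltW].
  apply: unbounded_height_infinite => N.
  have [q [Nq [p qp]]] := xA N.
  have h0 : (0 < height q)%N by exact: leq_ltn_trans Nq.
  (* At the coordinate t the entry -p M contributes -p M t = -p L, which turns closeness to L Z into
     a small linear form. *)
  pose q' : 'rV[int]_m.+1 := \row_i (if unlift ord0 i is Some j then q ord0 j else - (p * M%:Z)).
  have q'0 : q' ord0 ord0 = - (p * M%:Z) by rewrite mxE unlift_none.
  have q'S j : q' ord0 (lift ord0 j) = q ord0 j by rewrite mxE liftK.
  have q'form : \sum_(i < m.+1) (q' ord0 i)%:~R * tnth (tuple_cons (t, x)) i =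
      lin (q ord0) x - p%:~R * L.
    rewrite big_ord_recl q'0 /= rmorphN /= rmorphM /= addrC; congr (_ + _).
      by apply: eq_bigr => j _; rewrite q'S tnthS.
    by rewrite /L -pmulrn mulNr mulrA.
  have hq' : (height q <= height q')%N.
    by apply/bigmax_leqP => j _; rewrite -q'S height_ge.
  have linq : `|lin (q ord0) x| <= m%:R * (height q)%:R.
    rewrite /lin (le_trans (ler_norm_sum _ _ _))//.
    have -> : m%:R * (height q)%:R = \sum_(j < m) (height q)%:R :> R.
      by rewrite sumr_const card_ord mulr_natl.
    apply: ler_sum => j _; rewrite normrM -[leRHS]mulr1 ler_pM//.
      by rewrite -intr_norm -abszE -pmulrn ler_nat height_ge.
    have := x01 j; rewrite /= in_itv/= => /andP[xj0 xj1].
    by rewrite ger0_norm// ltW.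
  have hC : (height q' <= C * height q)%N.
    apply/bigmax_leqP => i _; case: (unliftP ord0 i) => [j|] ->.
      by rewrite q'S (leq_trans (height_ge _ _))// leq_pmull.
    rewrite q'0 abszN -(ler_nat R) -(ler_pM2r t0) natrM.
    have -> : (`|(p * M%:Z)%R|)%:R * t = `|p%:~R * L| :> R.
      rewrite pmulrn abszE intr_norm rmorphM /= /L mulrA !normrM.
      by rewrite [in RHS](gtr0_norm t0) -pmulrn.
    have : `|p%:~R * L| <= m%:R * (height q)%:R + 1.
      have -> : p%:~R * L = lin (q ord0) x - (lin (q ord0) x - p%:~R * L) by ring.
      rewrite (le_trans (ler_normB _ _))// lerD// ltW// (lt_le_trans qp)//.
      exact: r1.
    move=> /le_trans; apply; rewrite mulrAC.
    rewrite (@le_trans _ _ (m.+1%:R * (height q)%:R))//; last by rewrite ler_wpM2r.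
    by rewrite -[m.+1%:R]natr1 mulrDl mul1r lerD2l ler1n.
  exists q'; last exact: leq_trans hq'.
  split.
    apply/eqP => q'E; have z : height (0 : 'rV[int]_m.+1) = 0%N.
      by rewrite /height big1// => i _; rewrite mxE.
    by move: hq'; rewrite q'E z leqn0 (gtn_eqF h0).
  rewrite q'form (lt_le_trans qp)// (le_trans (rpsi _ h0))// psid//.
  exact: leq_trans hq'.
pose QL := @box R m (fun=> `[0, L[%classic).
have mA := @measurable_approximable R L r m.
have mU : measurable unit_box by exact: measurable_cube.
have mQ : measurable QL by exact: measurable_cube.
have mV := measurable_section_tail t (@measurable_V R m.+1 psi).
have muU : nlebesgue_measure R m unit_box = 1%E.
  by rewrite nlebesgue_cube// expr1n.
have QLoo : (nlebesgue_measure R m QL < +oo)%E by rewrite nlebesgue_cube// ltry.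
have UQ : unit_box `<=` QL.
  by move=> x xU i; have := xU i; rewrite /= !in_itv/= => /andP[-> /lt_le_trans->].
rewrite -muU -(measure_setI_full mU mQ mA UQ QLoo full).
apply: le_measure; rewrite ?inE; [exact: measurableI|exact: mV|].
by move=> x [xA xU]; exact: sub.
Qed.

(** The sections are integrated over t in ]0, 1], where they have measure at least 1; leaving out t
    = 0 costs nothing. *)
Lemma V_full_measure : nlebesgue_measure R m.+1 (V m.+1 psi) = 1%E.
Proof.
have mB : measurable (@box R m.+1 (fun=> `[0, 1]%classic)) by exact: measurable_box.
have mV := @measurable_V R m.+1 psi.
apply/le_anti/andP; split.
  rewrite -[leRHS](nlebesgue_unit_cube R m.+1); apply: le_measure; rewrite ?inE//.
  by move=> x [x01 _] i; rewrite /= in_itv/= x01.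
rewrite nlebesgue_measureS.
have mf := measurable_fun_measure_tail mV.
apply: (@le_trans _ _ (\int[@lebesgue_measure R]_(t in `](0 : R)%R, 1%R])
    nlebesgue_measure R m [set x | V m.+1 psi (tuple_cons (t, x))])%E).
  have mI : measurable (`](0 : R)%R, 1%R]%classic : set (measurableTypeR R)) by [].
  have mu01 : @lebesgue_measure R `](0 : R)%R, 1%R]%classic = 1%E.
    by rewrite lebesgue_measure_itv/= lte_fin ltr01 oppr0 adde0.
  have I1 : (\int[@lebesgue_measure R]_(t in `](0 : R)%R, 1%R]) cst 1 t = 1)%E.
    rewrite (integral_cst (@lebesgue_measure R) mI 1%E) mul1e; exact: mu01.
  rewrite -[leLHS]I1.
  apply: ge0_le_integral => //; first exact: measurable_funTS.
  move=> t; rewrite /= in_itv/= => t01; exact: V_section_measure.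
by apply: ge0_subset_integral.
Qed.

End divergence.

(** * The convergent case *)

Section strip_upper_bound.
Context (R : realType).
Local Notation mu := (@lebesgue_measure R).
Local Notation cube n := (@box R n (fun=> `[0, 1]%classic)).

(** The offset c carries the contribution of the coordinates already fixed in the induction of
    [affine_strip_measure]. *)
Definition affine_strip n (q : 'I_n -> int) (c delta : R) : set (euclidean R n) :=
  [set x | `|lin q x + c| < delta] `&` cube n.

Lemma measurable_affine_strip n (q : 'I_n -> int) c delta :
  measurable (affine_strip q c delta).
Proof.
apply: measurableI; last exact: measurable_box.
by apply: measurable_norm_lt; apply: measurable_funD => //; exact: measurable_lin.
Qed.

Lemma lin_tuple_cons n (q : 'I_n.+1 -> int) a (x : euclidean R n) :
  lin q (tuple_cons (a, x)) = (q ord0)%:~R * a + lin (q \o lift ord0) x.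
Proof.
by rewrite /lin big_ord_recl /=; congr (_ + _); apply: eq_bigr => i _; rewrite tnthS.
Qed.

Lemma lebesgue_affine_interval (a c delta : R) : a != 0 -> 0 < delta ->
  mu [set x | `|a * x + c| < delta] = (2 * delta / `|a|)%:E.
Proof.
move=> a0 d0; have na : 0 < `|a| by rewrite normr_gt0.
rewrite (_ : [set x | _] = `](- c / a - delta / `|a|), (- c / a + delta / `|a|)[%classic).
  rewrite lebesgue_measure_itv/= lte_fin ltrD2l gt0_cp ?divr_gt0// -EFinB.
  by congr EFin; ring.
have e x : `|a * x + c| = `|x - - c / a| * `|a|.
  by rewrite -normrM; congr `|_|; field.
by apply/seteqP; split=> x; rewrite /= in_itv/= -ltr_distl ltr_pdivlMr// e.
Qed.

(** The coordinates before i are fixed one by one and pass into the offset. Once i is the head, it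
    is integrated first: its section lies in an interval of length 2 delta / |q_i|. *)
Lemma affine_strip_measure n (q : 'I_n -> int) c delta i : q i != 0 -> 0 < delta ->
  (nlebesgue_measure R n (affine_strip q c delta) <= (2 * delta / `|(q i)%:~R|)%:E)%E.
Proof.
move=> + d0; elim: n q c i => [|n IH] q c i; first by case: i.
have mS := measurable_affine_strip q c delta.
case: (unliftP ord0 i) => [j|] -> qi; last first.
  have K0 : 0 <= 2 * delta / `|(q ord0)%:~R| :> R.
    by rewrite divr_ge0// mulr_ge0// ltW.
  have mU : measurable (cube n) by exact: measurable_box.
  rewrite nlebesgue_measureS_swap//.
  rewrite -[leRHS]mule1 -(nlebesgue_unit_cube R n) -[X in (_ * nlebesgue_measure R n X)%E]setIT.
  rewrite -integral_indic// -ge0_integralZl_EFin//; last first.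
    by apply/measurable_EFinP; exact: measurable_indic.
  apply: ge0_le_integral => //.
  - exact: measurable_fun_measure_head.
  - by apply: measurable_funeM; apply/measurable_EFinP; exact: measurable_indic.
  move=> x _; rewrite indicE; have [xU|nxU] := pselect (cube n x); last first.
    rewrite memNset// mulr0n mule0.
    rewrite (_ : [set a | _] = set0) ?measure0//.
    apply/seteqP; split=> // a [_ ax]; apply: nxU => j.
    by have := ax (lift ord0 j); rewrite tnthS.
  rewrite mem_set// mule1 -(lebesgue_affine_interval (lin (q \o lift ord0) x + c) _ d0).
    apply: le_measure; rewrite ?inE.
    - exact: measurable_section_head.
    - by apply: measurable_norm_lt; apply: measurable_funD => //; exact: measurable_funM.
    - by move=> a [/= + _]; rewrite lin_tuple_cons addrA.
  by rewrite intr_eq0.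
have K0 : 0 <= 2 * delta / `|(q (lift ord0 j))%:~R| :> R.
  by rewrite divr_ge0// mulr_ge0// ltW.
rewrite nlebesgue_measureS.
have I01 : @lebesgue_measure R `[(0 : R), 1]%classic = 1%E.
  by rewrite lebesgue_measure_itv/= lte_fin ltr01 oppr0 adde0.
rewrite -[leRHS]mule1 -I01 -[X in (_ * lebesgue_measure X)%E]setIT.
rewrite -integral_indic// -ge0_integralZl_EFin//; last first.
  by apply/measurable_EFinP; exact: measurable_indic.
apply: ge0_le_integral => //.
- exact: measurable_fun_measure_tail.
- by apply: measurable_funeM; apply/measurable_EFinP; exact: measurable_indic.
move=> a _; rewrite indicE; have [a01|na01] := pselect (`[(0 : R), 1]%classic a); last first.
  rewrite memNset// mulr0n mule0.
  rewrite (_ : [set x | _] = set0) ?measure0//.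
  by apply/seteqP; split=> // x [_ /(_ ord0)].
rewrite mem_set// mule1; apply: le_trans (IH (q \o lift ord0) ((q ord0)%:~R * a + c) j qi).
apply: le_measure; rewrite ?inE.
- exact: measurable_section_tail.
- exact: measurable_affine_strip.
move=> x [/= + ax]; rewrite lin_tuple_cons => h; split.
  by rewrite /= addrA [lin _ _ + _]addrC.
by move=> k; have := ax (lift ord0 k); rewrite tnthS.
Qed.

End strip_upper_bound.

(** * Counting integer vectors of a given height *)

Definition centered_row n h (f : {ffun 'I_n -> 'I_(h.*2.+1)}) : 'rV[int]_n :=
  \row_i ((f i : nat)%:Z - h%:Z).

(** Shifting the entries by h encodes the vectors of height at most h as maps into {0, ..., 2h},
    which form a finite type. *)
Lemma centered_row_surj n h (q : 'rV[int]_n) : (height q <= h)%N ->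
  exists f, q = centered_row (h := h) f.
Proof.
move=> /bigmax_leqP qh.
exists [ffun i => inord `|(q ord0 i + h%:Z)%R|%N]; apply/rowP => i.
rewrite mxE ffunE; have := qh i isT; move: (q ord0 i) => a ah.
by rewrite inordK; lia.
Qed.

Lemma finite_bounded_height n h : finite_set [set q : 'rV[int]_n | (height q <= h)%N].
Proof.
apply: (@sub_finite_set _ _ (@centered_row n h @` setT)).
  by move=> q /centered_row_surj[f ->]; exists f.
exact: finite_image.
Qed.

(** Some entry is h or -h, encoded as 2h or 0: there are n + 1 positions and two values for it, and
    the other n entries are free. *)
Lemma card_centered_row n h :
  (#|[pred f : {ffun 'I_n.+1 -> 'I_(h.*2.+1)} | height (centered_row f) == h]| <=
   n.+1 * (2 * h.*2.+1 ^ n))%N.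
Proof.
pose S := [pred b : 'I_(h.*2.+1) | (b == 0 :> nat) || (b == h.*2 :> nat)].
pose P (i : 'I_n.+1) (f : {ffun 'I_n.+1 -> 'I_(h.*2.+1)}) := S (f i).
have cardS : (#|S| <= 2)%N.
  rewrite -[2%N]/(size [:: 0; h.*2]%N) cardE -(size_map val).
  apply: uniq_leq_size; first by rewrite (map_inj_uniq val_inj) enum_uniq.
  by move=> b /mapP[c]; rewrite mem_enum !inE => Sc ->.
have cardP i : (#|[pred f | P i f]| <= 2 * h.*2.+1 ^ n)%N.
  pose F (j : 'I_n.+1) : pred 'I_(h.*2.+1) := if j == i then S else predT.
  rewrite (_ : #|[pred f | P i f]| = #|family F|).
    rewrite card_family foldrE big_map big_enum /= (bigD1 i)//= {1}/F eqxx.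
    rewrite leq_mul//.
    rewrite (eq_bigr (fun=> h.*2.+1)); last first.
      by move=> j /negbTE ji; rewrite /F ji card_ord.
    by rewrite prod_nat_const cardC1 card_ord.
  apply: eq_card => f; rewrite !inE; apply/idP/familyP.
    by move=> Pf j; rewrite /F; case: eqVneq => // ->.
  by move=> /(_ i); rewrite /F eqxx.
apply: (@leq_trans (\sum_(i < n.+1) #|[pred f | P i f]|)); last first.
  rewrite -[n.+1 in leqRHS]card_ord -sum_nat_const.
  by apply: leq_sum => i _; exact: cardP.
rewrite (eq_bigr (fun i => \sum_f P i f)%N); last first.
  move=> i _; rewrite -sum1_card (eq_bigl (P i))// big_mkcond.
  by apply: eq_bigr => f _; case: (P i f).
rewrite exchange_big /= -sum1_card big_mkcond; apply: leq_sum => f _ /=.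
case: ifP => // /eqP hf.
have card0 : (0 < #|'I_n.+1|)%N by rewrite card_ord.
have [i hi] := bigop.eq_bigmax (fun i => `|centered_row f ord0 i|%N) card0.
rewrite -/(height _) hf mxE in hi.
rewrite (bigD1 i)//= (_ : P i f = true :> bool)//.
rewrite /P /S /=; move: hi; have := ltn_ord (f i).
move: (f i : nat) => a; lia.
Qed.

Lemma measure_bigsetU_le d (T : measurableType d) (R : realType)
    (mu : {measure set T -> \bar R}) (I : finType) (P : pred I) (A : I -> set T) :
  (forall i, measurable (A i)) ->
  (mu (\big[setU/set0]_(i | P i) A i) <= \sum_(i | P i) mu (A i))%E.
Proof.
move=> mA; suff [] : measurable (\big[setU/set0]_(i | P i) A i) /\
  (mu (\big[setU/set0]_(i | P i) A i) <= \sum_(i | P i) mu (A i))%E by [].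
apply: (big_ind2 (fun B x => measurable B /\ (mu B <= x)%E)).
- by rewrite measure0.
- move=> B x C y [mB Bx] [mC Cy]; split; first exact: measurableU.
  by apply: le_trans (measureU2 _ mB mC) _; exact: leeD.
- by move=> i _.
Qed.

Lemma nneseries_EFin_lty (R : realType) (u : nat -> R) :
  cvgn (series u) -> (\sum_(k <oo) (u k)%:E < +oo)%E.
Proof.
move=> cu; rewrite (_ : (fun n => \sum_(0 <= k < n) (u k)%:E)%E = EFin \o series u).
  by rewrite EFin_lim// ltry.
by apply/funext => n; rewrite /series /= sumEFin.
Qed.

(** * The Borel-Cantelli argument *)

Section convergence.
Context (R : realType) (l : nat) (psi : nat -> R).
Local Notation n := l.+2.
Local Notation mun := (nlebesgue_measure R n).
Hypothesis psi0 : forall k, (0 < k)%N -> 0 < psi k.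
Hypothesis conv : cvgn (series (fun k => k.+1%:R ^+ l * psi k.+1)).

Let S h (q : 'rV[int]_n) : set (euclidean R n) :=
  affine_strip (q ord0) 0 (psi h).

Let F k : set (euclidean R n) :=
  \big[setU/set0]_(f : {ffun 'I_n -> 'I_(k.+1.*2.+1)} |
    height (centered_row f) == k.+1) S k.+1 (centered_row f).

Let mF k : measurable (F k).
Proof. by apply: bigsetU_measurable => f _; exact: measurable_affine_strip. Qed.

(** The 4 joins the 2 of the strip bound and the 2 of the count; the 3 comes from 2 (k + 1) + 1 <= 3
    (k + 1). *)
Let C : R := (4 * n * 3 ^ l.+1)%N%:R.

(** About (k + 1)^(l + 1) vectors have height k + 1. Each has an entry of that absolute value, so
    its strip has measure at most 2 psi(k + 1) / (k + 1). *)
Let F_measure k : (mun (F k) <= (C * (k.+1%:R ^+ l * psi k.+1))%:E)%E.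
Proof.
have kR : (0 : R) < k.+1%:R by rewrite ltr0n.
have p0 : 0 < psi k.+1 by exact: psi0.
apply: le_trans (measure_bigsetU_le _ _ _) _.
  by move=> f; exact: measurable_affine_strip.
pose B : \bar R := (2 * psi k.+1 / k.+1%:R)%:E.
apply: (@le_trans _ _ (\sum_(f : {ffun 'I_n -> 'I_(k.+1.*2.+1)} |
    height (centered_row f) == k.+1) B)%E).
  apply: lee_sum => f /eqP hf.
  have card0 : (0 < #|'I_n|)%N by rewrite card_ord.
  have [i hi] := bigop.eq_bigmax (fun i => `|centered_row f ord0 i|%N) card0.
  rewrite -/(height _) hf in hi.
  have q0 : centered_row f ord0 i != 0 by rewrite -absz_eq0 -hi.
  apply: le_trans (affine_strip_measure _ q0 p0) _.
  by rewrite /B -intr_norm -abszE -hi -pmulrn.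
rewrite /B sumEFin lee_fin sumr_const -[leLHS]mulr_natr.
apply: (@le_trans _ _ (2 * psi k.+1 / k.+1%:R * (n * (2 * k.+1.*2.+1 ^ l.+1))%N%:R)).
  rewrite ler_wpM2l ?divr_ge0 ?mulr_ge0 ?(ltW p0)// ler_nat.
  exact: card_centered_row.
have -> : C * (k.+1%:R ^+ l * psi k.+1) =
    2 * psi k.+1 / k.+1%:R * (n * (2 * (3 * k.+1) ^ l.+1))%N%:R.
  rewrite /C !natrM !natrX natrM exprMn [k.+1%:R ^+ l.+1]exprS; field.
  by rewrite ?nat1r ?natr1 pnatr_eq0.
apply: ler_wpM2l; first by rewrite divr_ge0// mulr_ge0// ltW.
rewrite ler_nat leq_mul2l leq_mul2l /= leq_exp2r// -addnn; lia.
Qed.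

Lemma V_null : mun (V n psi) = 0%E.
Proof.
have F0 : mun (lim_sup_set F) = 0%E.
  apply: lim_sup_set_cvg0 => //.
  apply: (@le_lt_trans _ _ (\sum_(k <oo) (C * (k.+1%:R ^+ l * psi k.+1))%:E)%E).
    by apply: lee_nneseries => k // _; exact: F_measure.
  by apply: nneseries_EFin_lty; exact: (@is_cvg_seriesZ _ _ C conv).
have mL : measurable (lim_sup_set F).
  by apply: bigcapT_measurable => N; exact: bigcup_measurable.
apply: (subset_measure0 _ mL _ F0); first exact: measurable_V.
move=> x [x01 xoo] N _.
(* Finitely many vectors have height at most N, so some solution q has a larger height. *)
have /infinite_setN0[q [[q0 xq] /negP]] :=
  infinite_setD xoo (finite_bounded_height n N).
rewrite -ltnNge => Nq.
have [k hk] : exists k, height q = k.+1 by case: (height q) Nq => // k _; exists k.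
(* As [F k] collects height k + 1, the bound N < k + 1 is the N <= k asked by the limsup. *)
exists k; first by rewrite hk in Nq.
have [f qf] := @centered_row_surj n k.+1 q (eq_leq hk).
rewrite /F (bigD1 f) /=; last by rewrite -qf hk.
left; rewrite -qf; split; last by move=> i; rewrite /= in_itv/= x01.
by rewrite /= addr0 -hk.
Qed.

End convergence.

Unset Implicit Arguments.

Theorem theorem2 (R : realType) (n : nat) (psi : nat -> R)
    (hn : (2 <= n)%N)
    (psi_gt0 : forall k : nat, (0 < k)%N -> 0 < psi k)
    (psi_cvg0 : psi k @[k --> \oo] --> 0) :
  (cvgn (series (fun k : nat => k.+1%:R ^+ (n - 2) * psi k.+1)) ->
     nlebesgue_measure R n (V n psi) = 0%E) /\
  (~ cvgn (series (fun k : nat => k.+1%:R ^+ (n - 2) * psi k.+1)) ->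
     slowly_decreasing psi ->
     nlebesgue_measure R n (V n psi) = 1%E).
Proof.
case: n hn => [//|[//|l]] _; rewrite subn2 /=; split; first exact: V_null.
by move=> ndiv; exact: V_full_measure.
Qed.
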